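(* Let $\boldsymbol\mu\in\mathbb{R}^n$, let $\boldsymbol\Sigma\in\mathbb{R}^{n\times n}$ be positive definite, and consider the hierarchical Vecchia (HV) approximation $\hat p(\mathbf{x})$ of $\mathcal{N}_n(\boldsymbol\mu,\boldsymbol\Sigma)$ with conditioning sets $\mathcal{C}_1,\ldots,\mathcal{C}_n$. Let $\mathcal{I}\subset\{1,\ldots,n\}$ and data $\mathbf{y}\mid\mathbf{x}\sim\mathcal{N}(\mathbf{H}\mathbf{x},\mathbf{R})$, where $\mathbf{H}$ consists of the rows with indices in $\mathcal{I}$ of the $n\times n$ identity matrix and $\mathbf{R}$ is diagonal with entries $\tau_i^2>0$, $i\in\mathcal{I}$. Assume that $|\mathcal{C}_i|\le N$ for all $i=1,\ldots,n$, where $N\geq 1$. Then the following algorithm (HV posterior inference) can be carried out in $\mathcal{O}(nN^2)$ time and $\mathcal{O}(nN)$ space: 1. $\mathbf{L}=\mathrm{ichol}(\boldsymbol\Sigma,\mathbf{S})$; 2. $\mathbf{U}=\mathbf{L}^{-\top}$; 3. $\boldsymbol\Lambda=\mathbf{U}\mathbf{U}^\top+\mathbf{H}^\top\mathbf{R}^{-1}\mathbf{H}$; 4. $\widetilde{\mathbf{U}}=\mathbf{P}\,\mathrm{chol}(\mathbf{P}\boldsymbol\Lambda\mathbf{P})\,\mathbf{P}$; 5. $\widetilde{\mathbf{L}}=\widetilde{\mathbf{U}}^{-\top}$; 6. $\widetilde{\boldsymbol\mu}=\boldsymbol\mu+\widetilde{\mathbf{L}}\widetilde{\mathbf{L}}^\top\mathbf{H}^\top\mathbf{R}^{-1}(\mathbf{y}-\mathbf{H}\boldsymbol\mu)$.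 Here $\mathbf{S}\in\{0,1\}^{n\times n}$ is the lower-triangular matrix with $\mathbf{S}_{i,j}=1$ if $x_j\in\mathcal{C}_i$ or $i=j$, and $\mathbf{S}_{i,j}=0$ otherwise, and $\mathbf{P}$ is the order-reversing permutation matrix.
   Context: The algorithm's input is $\mathbf{y},\mathbf{S},\boldsymbol\mu,\boldsymbol\Sigma,\mathbf{H},\mathbf{R}$ and its output is $\widetilde{\boldsymbol\mu}$ and $\widetilde{\mathbf{L}}$, which describe the posterior $\hat p(\mathbf{x}\mid\mathbf{y})=\mathcal{N}_n(\mathbf{x}\mid\widetilde{\boldsymbol\mu},\widetilde{\mathbf{L}}\widetilde{\mathbf{L}}^\top)$. Time is the number of elementary operations (arithmetic operations and square roots on reals), space is the number of stored numbers; matrices are stored in sparse form, the sparsity pattern $\mathbf{S}$ is known in advance, and only the entries $\boldsymbol\Sigma_{i,j}$ with $\mathbf{S}_{i,j}=1$ need to be accessed and stored. The constants in $\mathcal{O}(\cdot)$ are universal. For a symmetric positive-definite matrix $\mathbf{A}$, $\mathrm{chol}(\mathbf{A})$ is the unique lower-triangular matrix $\mathbf{B}$ with positive diagonal and $\mathbf{B}\mathbf{B}^\top=\mathbf{A}$; $\mathbf{L}^{-\top}=(\mathbf{L}^{-1})^\top$; $\mathbf{P}_{i,n+1-i}=1$ with zeros elsewhere. Incomplete Cholesky decomposition: $\mathrm{ichol}(\mathbf{A},\mathbf{S})$ is the lower-triangular matrix $\mathbf{L}$ computed as follows, with all entries not assigned equal to $0$. For $i=1,\ldots,n$: for $j=1,\ldots,i-1$,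 if $\mathbf{S}_{i,j}=1$ set $\mathbf{L}_{i,j}=\bigl(\mathbf{A}_{i,j}-\sum_{k=1}^{j-1}\mathbf{L}_{i,k}\mathbf{L}_{j,k}\bigr)/\mathbf{L}_{j,j}$; then set $\mathbf{L}_{i,i}=\bigl(\mathbf{A}_{i,i}-\sum_{k=1}^{i-1}\mathbf{L}_{i,k}^2\bigr)^{1/2}$. Hierarchical partition: let $\mathbf{x}=(x_1,\ldots,x_n)^\top$, $M\ge 0$ and $J_1,\ldots,J_M\ge 1$. The elements of $\mathbf{x}$ are partitioned into pairwise disjoint sets $\mathcal{X}_{j_1,\ldots,j_m}$, indexed by $m\in\{0,\ldots,M\}$ and $j_k\in\{1,\ldots,J_k\}$ for $k=1,\ldots,m$ (for $m=0$ there is a single set, written $\mathcal{X}$). Level $m$ is $\mathcal{X}^0=\mathcal{X}$ and $\mathcal{X}^m=\bigcup_{j_1=1}^{J_1}\cdots\bigcup_{j_m=1}^{J_m}\mathcal{X}_{j_1,\ldots,j_m}$ for $m\ge1$; the union of all levels consists of all elements of $\mathbf{x}$. The ordering of $\mathbf{x}$ is compatible with the levels: if $i>j$, $x_i\in\mathcal{X}^{m_1}$ and $x_j\in\mathcal{X}^{m_2}$, then $m_1\ge m_2$. Ancestors and HV approximation: the ancestor set of $\mathcal{X}_{j_1,\ldots,j_m}$ is $\mathcal{A}_{j_1,\ldots,j_m}=\mathcal{X}\cup\mathcal{X}_{j_1}\cup\mathcal{X}_{j_1,j_2}\cup\cdots\cup\mathcal{X}_{j_1,\ldots,j_{m-1}}$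 (empty for $m=0$). With $p$ denoting (conditional) densities under $\mathcal{N}_n(\boldsymbol{\mu},\boldsymbol{\Sigma})$, the HV approximation is $\hat p(\mathbf{x})=\prod_{m=0}^M\prod_{j_1,\ldots,j_m}p(\mathcal{X}_{j_1,\ldots,j_m}\mid\mathcal{A}_{j_1,\ldots,j_m})=\prod_{i=1}^n p(x_i\mid\mathcal{C}_i)$, where the conditioning set of $x_i\in\mathcal{X}_{j_1,\ldots,j_m}$ is $\mathcal{C}_i=\mathcal{A}_{j_1,\ldots,j_m}\cup\{x_k\in\mathcal{X}_{j_1,\ldots,j_m}:k<i\}$. *)

(* Defs.v *)
From HB Require Import structures.
From mathcomp Require Import all_boot all_order all_algebra.
From mathcomp Require Import reals.

Set Implicit Arguments.
Unset Strict Implicit.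
Unset Printing Implicit Defensive.

Import Order.TTheory GRing.Theory Num.Theory.
Local Open Scope ring_scope.

Section Hierarchy.
Variables (n M : nat) (J : M.-tuple nat).

(* [:: j_1; ...; j_m] with m <= M and 1 <= j_k <= J_k; the sequence J is
   indexed from 0, so J_k is its entry k - 1. *)
Definition hindex (s : seq nat) : bool :=
  (size s <= M)%N &&
  [forall k : 'I_(size s), (1 <= nth 0 s k)%N && (nth 0 s k <= nth 0 J k)%N].

(* X s is the set of (positions of) the elements of X_{j_1,...,j_m} for
   s = [:: j_1; ...; j_m]; its value is irrelevant unless [hindex s]. *)
Variable X : seq nat -> {set 'I_n}.

Definition in_level (m : nat) (i : 'I_n) : Prop :=
  exists s, [/\ hindex s, size s = m & i \in X s].

Record hierarchical_partition : Prop := HierarchicalPartition {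
  hp_bounds : all (leq 1) J;
  hp_disjoint : forall s t, hindex s -> hindex t -> s != t ->
    [disjoint X s & X t];
  hp_cover : forall i, exists2 s, hindex s & i \in X s;
  hp_order : forall (i j : 'I_n) m1 m2, (j < i)%N ->
    in_level m1 i -> in_level m2 j -> (m2 <= m1)%N }.

Definition ancestors (s : seq nat) : {set 'I_n} :=
  \bigcup_(m < size s) X (take m s).

Definition conditioning_sets (C : 'I_n -> {set 'I_n}) : Prop :=
  forall s i, hindex s -> i \in X s ->
    C i = ancestors s :|: [set k in X s | (k < i)%N].

End Hierarchy.

Definition sparsity n (C : 'I_n -> {set 'I_n}) : 'M[bool]_n :=
  \matrix_(i, j) ((j \in C i) || (i == j)).

Section MatrixNotions.
Variables (R : realType) (n : nat).
Implicit Types (A B L : 'M[R]_n) (S : 'M[bool]_n) (I : {set 'I_n}).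

Definition posdefmx A : Prop :=
  A^T = A /\ forall v : 'cV[R]_n, v != 0 -> 0 < (v^T *m A *m v) 0 0.

Definition set_entry L (i j : 'I_n) (a : R) : 'M[R]_n :=
  \matrix_(p, q) if (p == i) && (q == j) then a else L p q.

Definition ichol_offdiag A S (i : 'I_n) L (j : 'I_n) : 'M[R]_n :=
  if S i j then
    set_entry L i j
      ((A i j - \sum_(k < n | (k < j)%N) L i k * L j k) / L j j)
  else L.

Definition ichol_diag A (i : 'I_n) L : 'M[R]_n :=
  set_entry L i i (Num.sqrt (A i i - \sum_(k < n | (k < i)%N) L i k ^+ 2)).

Definition ichol_row A S L (i : 'I_n) : 'M[R]_n :=
  ichol_diag A i
    (foldl (ichol_offdiag A S i) L [seq j : 'I_n <- enum 'I_n | (j < i)%N]).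

(* This function is total because division and [Num.sqrt] are; no division
   by zero or square root of a negative number has taken place as soon as
   all the diagonal entries of the result are positive. *)
Definition ichol A S : 'M[R]_n := foldl (ichol_row A S) 0 (enum 'I_n).

Definition is_chol A B : Prop :=
  [/\ forall i j : 'I_n, (i < j)%N -> B i j = 0,
      forall i : 'I_n, 0 < B i i
    & B *m B^T = A].

Definition revmx : 'M[R]_n := \matrix_(i, j) (j == rev_ord i)%:R.

Definition obsmx I : 'M[R]_(#|I|, n) := \matrix_(a, j) (j == enum_val a)%:R.

Definition noisemx I (tau : 'I_n -> R) : 'M[R]_#|I| :=
  diag_mx (\row_a tau (enum_val a) ^+ 2).

End MatrixNotions.

Arguments revmx {R n}.

(* The matrices defined by the six steps, together with the facts that make
   each step meaningful (no failing operation in ichol, invertible factors);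
   V is the noise covariance. *)
Record hv_steps (R : realType) n (S : 'M[bool]_n) q (mu : 'cV[R]_n)
    (Sigma : 'M[R]_n) (H : 'M[R]_(q, n)) (V : 'M[R]_q) (y : 'cV[R]_q)
    (L U Lam Ut Lt : 'M[R]_n) (mut : 'cV[R]_n) : Prop := HVSteps {
  hv_L : L = ichol Sigma S;
  hv_L_defined : forall i, 0 < L i i;
  hv_L_unit : L \in unitmx;
  hv_U : U = (invmx L)^T;
  hv_V_unit : V \in unitmx;
  hv_Lam : Lam = U *m U^T + H^T *m invmx V *m H;
  hv_Ut : exists2 B, is_chol (revmx *m Lam *m revmx) B
                   & Ut = revmx *m B *m revmx;
  hv_Ut_unit : Ut \in unitmx;
  hv_Lt : Lt = (invmx Ut)^T;
  hv_mut : mut = mu + Lt *m Lt^T *m H^T *m invmx V *m (y - H *m mu) }.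

(* Straight-line programs over a memory of s real numbers. There is no
   control flow or indirect addressing: these may depend only on the
   structure known in advance, and only operations on reals are counted.
   Copies and the constants 0 and 1 also take one unit of time. *)
Inductive instr (s : nat) : Type :=
| IConst (dst : 'I_s) (b : bool)
| ICopy (dst a : 'I_s)
| IAdd (dst a b : 'I_s)
| ISub (dst a b : 'I_s)
| IMul (dst a b : 'I_s)
| IDiv (dst a b : 'I_s)
| ISqrt (dst a : 'I_s).

Definition program (s : nat) := seq (instr s).

Section Semantics.
Variables (R : realType) (s : nat).

Definition memory := 'I_s -> R.

Definition write (m : memory) (dst : 'I_s) (x : R) : memory :=
  fun a => if a == dst then x else m a.

(* None: division by zero, or square root of a negative number *)
Definition exec_instr (i : instr s) (m : memory) : option memory :=
  match i with
  | IConst dst b => Some (write m dst b%:R)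
  | ICopy dst a => Some (write m dst (m a))
  | IAdd dst a b => Some (write m dst (m a + m b))
  | ISub dst a b => Some (write m dst (m a - m b))
  | IMul dst a b => Some (write m dst (m a * m b))
  | IDiv dst a b => if m b == 0 then None else Some (write m dst (m a / m b))
  | ISqrt dst a => if m a < 0 then None
                   else Some (write m dst (Num.sqrt (m a)))
  end.

Fixpoint exec (p : program s) (m : memory) : option memory :=
  if p is i :: p' then obind (exec p') (exec_instr i m) else Some m.

(* Sparse storage: the entries without a cell are zero. *)
Definition stores_mx n (loc : 'I_n -> 'I_n -> option 'I_s) (m : memory)
    (A : 'M[R]_n) : Prop :=
  forall i j, A i j = if loc i j is Some a then m a else 0.

Definition stores_vec n (loc : 'I_n -> 'I_s) (m : memory) (v : 'cV[R]_n) :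
    Prop :=
  forall i, v i 0 = m (loc i).

End Semantics.

(* The stored input numbers: the entries Sigma_{i,j} with S_{i,j} = 1, and mu,
   y and the nonzero entries of H and of the noise covariance. *)
Inductive input n (S : 'M[bool]_n) (I : {set 'I_n}) : Type :=
| InSigma i j of S i j
| InMu of 'I_n
| InY of 'I_#|I|
| InH of 'I_#|I|
| InV of 'I_#|I|.

Definition input_value (R : realType) n (S : 'M[bool]_n) (I : {set 'I_n})
    (mu : 'cV[R]_n) (Sigma : 'M[R]_n) (H : 'M[R]_(#|I|, n)) (V : 'M[R]_#|I|)
    (y : 'cV[R]_#|I|) (x : input S I) : R :=
  match x with
  | InSigma i j _ => Sigma i j
  | InMu i => mu i 0
  | InY a => y a 0
  | InH a => H a (enum_val a)
  | InV a => V a a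
  end.

(* A program for the six steps, with its memory layouts. The cells of the
   input are counted in hv_space. *)
Record hv_program n (S : 'M[bool]_n) (I : {set 'I_n}) : Type := HVProgram {
  hv_space : nat;
  hv_input : input S I -> 'I_hv_space;
  hv_prog1 : program hv_space;
  hv_prog2 : program hv_space;
  hv_prog3 : program hv_space;
  hv_prog4 : program hv_space;
  hv_prog5 : program hv_space;
  hv_prog6 : program hv_space;
  loc_L : 'I_n -> 'I_n -> option 'I_hv_space;
  loc_U : 'I_n -> 'I_n -> option 'I_hv_space;
  loc_Lam : 'I_n -> 'I_n -> option 'I_hv_space;
  loc_Ut : 'I_n -> 'I_n -> option 'I_hv_space;
  loc_Lt : 'I_n -> 'I_n -> option 'I_hv_space;
  loc_mut : 'I_n -> 'I_hv_space }.

Definition hv_time n (S : 'M[bool]_n) (I : {set 'I_n}) (p : hv_program S I) :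
    nat :=
  (size (hv_prog1 p) + size (hv_prog2 p) + size (hv_prog3 p) +
   size (hv_prog4 p) + size (hv_prog5 p) + size (hv_prog6 p))%N.

(* Started from any memory containing the input (whatever the other cells
   contain), the program runs without a failing operation; the result of each
   step is in memory after that step, and both outputs at the end. *)
Definition hv_correct (R : realType) n (S : 'M[bool]_n) (I : {set 'I_n})
    (p : hv_program S I) (mu : 'cV[R]_n) (Sigma : 'M[R]_n)
    (H : 'M[R]_(#|I|, n)) (V : 'M[R]_#|I|) (y : 'cV[R]_#|I|) : Prop :=
  forall m0 : memory R (hv_space p),
  (forall x, m0 (hv_input p x) = input_value mu Sigma H V y x) ->
  exists (L U Lam Ut Lt : 'M[R]_n) (mut : 'cV[R]_n)
         (m1 m2 m3 m4 m5 m6 : memory R (hv_space p)),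
  hv_steps S mu Sigma H V y L U Lam Ut Lt mut /\
  [/\ exec (hv_prog1 p) m0 = Some m1 /\ stores_mx (loc_L p) m1 L,
      exec (hv_prog2 p) m1 = Some m2 /\ stores_mx (loc_U p) m2 U,
      exec (hv_prog3 p) m2 = Some m3 /\ stores_mx (loc_Lam p) m3 Lam,
      exec (hv_prog4 p) m3 = Some m4 /\ stores_mx (loc_Ut p) m4 Ut
    & exec (hv_prog5 p) m4 = Some m5 /\ stores_mx (loc_Lt p) m5 Lt] /\
  [/\ exec (hv_prog6 p) m5 = Some m6, stores_mx (loc_Lt p) m6 Lt
    & stores_vec (loc_mut p) m6 mut].

(* Main.v *)
(* The relation "j = i or x_j is in C_i" is the ancestor relation of a forest:
   it is transitive, and any two ancestors of a node are comparable. Hence lower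
   triangular matrices with this sparsity pattern are closed under inversion,
   U U^T vanishes outside the pattern and its transpose, and elimination from
   the leaves to the roots produces no fill-in, so that
   chol (P Lambda P) = ichol (P Lambda P) for the reversed pattern. The pivots
   of both incomplete factorizations are positive because each is the value of
   the positive definite quadratic form at a vector supported on a set of
   pairwise comparable or decoupled indices. Every entry of every matrix is then
   a start value minus or plus a sum of products indexed by chains k -> i -> j of
   the forest, of which there are at most n (N + 1)^2. *)
Require Import Defs.
From HB Require Import structures.
From mathcomp Require Import all_boot all_order all_algebra.
From mathcomp Require Import reals.
From mathcomp Require Import zify.

Set Implicit Arguments.
Unset Strict Implicit.
Unset Printing Implicit Defensive.

Import Order.TTheory GRing.Theory Num.Theory.
Local Open Scope ring_scope.

(** * Forest patterns and the incomplete Cholesky recurrences *)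

Record order_pattern n (T : 'M[bool]_n) : Prop := OrderPattern {
  pat_refl : forall i, T i i;
  pat_low : forall i j, T i j -> (j <= i)%N;
  pat_trans : forall i j k, T i j -> T j k -> T i k }.

Definition patterned (R : nmodType) n (T : 'M[bool]_n) (A : 'M[R]_n) : Prop :=
  forall i j, ~~ T i j -> A i j = 0.

(** Let [s] index the set of i. Then [j \in C i] means that j lies in [X (take m s)] for some m,
    with j before i when m is the full length. Prefixes of prefixes are prefixes, whence
    transitivity. For the last clause, two prefixes of one [s] are nested by length, and [hp_order]
    makes length follow position. *)
Lemma hierarchy_order_pattern n M (J : M.-tuple nat) X (C : 'I_n -> {set 'I_n}) :
  hierarchical_partition J X -> conditioning_sets J X C ->
  order_pattern (sparsity C) /\
  (forall i j k, sparsity C i j -> sparsity C i k -> (k <= j)%N ->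
     sparsity C j k).
Proof.
move=> hp hC.
have idx_take s m : hindex J s -> hindex J (take m s).
  move=> /andP[hs /forallP hk]; apply/andP; split.
    by apply: leq_trans hs; rewrite size_take_min geq_minr.
  apply/forallP => k.
  have /andP[km ks] : (k < m)%N && (k < size s)%N.
    by rewrite -leq_min -size_take_min ltn_ord.
  by rewrite nth_take //; exact: (hk (Ordinal ks)).
have sz_take s m : (m < size s)%N -> size (take m s) = m.
  by move=> ms; rewrite size_take ms.
have CP s i j : hindex J s -> i \in X s -> reflect
    (exists2 m, (m <= size s)%N & j \in X (take m s) /\ (m = size s -> j < i)%N)
    (j \in C i).
  move=> hs iX; rewrite (hC s i hs iX) !inE.
  apply: (iffP orP) => [[|/andP[jX ji]]|[m ms [jX ji]]].
  - case/bigcupP=> m _ jX; exists (val m); first exact: (ltnW (ltn_ord m)).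
    by split=> // e; have := ltn_ord m; rewrite e ltnn.
  - by exists (size s) => //; rewrite take_size.
  - move: ms; rewrite leq_eqVlt => /orP[/eqP e|ms].
      by right; move: jX; rewrite e take_size => ->; rewrite ji.
    by left; apply/bigcupP; exists (Ordinal ms).
have lvl s i : hindex J s -> i \in X s -> in_level J X (size s) i.
  by move=> hs iX; exists s.
have same s t i : hindex J s -> hindex J t -> i \in X s -> i \in X t -> s = t.
  move=> hs ht iXs iXt; apply/eqP/contraT => /(hp_disjoint hp hs ht).
  by move=> /disjointFr /(_ iXs); rewrite iXt.
(* The contrapositive of [hp_order] gives only j <= i; equality is excluded because an element
   cannot lie in two distinct sets. *)
have lvl_lt s t i j : hindex J s -> hindex J t -> i \in X s -> j \in X t ->
    (size t < size s)%N -> (j < i)%N.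
  move=> hs ht iX jX lt; rewrite ltnNge leq_eqVlt; apply/negP => /orP[/eqP e|ij].
    have ij : i = j by exact: val_inj.
    by move: lt; rewrite (same s t i) ?ltnn // ij.
  by have := hp_order hp ij (lvl _ _ ht jX) (lvl _ _ hs iX); rewrite leqNgt lt.
have low i j : j \in C i -> (j < i)%N.
  have [s hs iX] := hp_cover hp i; move=> /(CP s i j hs iX)[m ms [jX]].
  move: ms; rewrite leq_eqVlt => /orP[/eqP -> /(_ erefl) //|ms _].
  by apply: (lvl_lt s (take m s)) => //; [exact: idx_take|rewrite sz_take].
have trans i j k : j \in C i -> k \in C j -> k \in C i.
  have [s hs iX] := hp_cover hp i; move=> /(CP s i j hs iX)[m ms [jX ji]].
  move=> /(CP (take m s) j k (idx_take _ _ hs) jX)[m' ms' [kX kj]].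
  apply/(CP s i k hs iX); rewrite size_take_min in ms' kj.
  move: ms'; rewrite leq_min => /andP[m'm m's]; exists m' => //; split.
    by move: kX; rewrite take_takel.
  move=> e; have em : m = size s by apply/eqP; rewrite eqn_leq ms -e.
  apply: (@ltn_trans j); last exact: ji.
  by apply: kj; rewrite em minnn.
have chain i j k : j \in C i -> k \in C i -> (k < j)%N -> k \in C j.
  have [s hs iX] := hp_cover hp i; move=> /(CP s i j hs iX)[m ms [jX ji]].
  move=> /(CP s i k hs iX)[m' ms' [kX ki]] kj.
  have m'm : (m' <= m)%N.
    have := hp_order hp kj (lvl _ _ (idx_take _ _ hs) jX)
                           (lvl _ _ (idx_take _ _ hs) kX).
    by rewrite !size_takel.
  apply/(CP (take m s) j k (idx_take _ _ hs) jX).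
  rewrite size_takel //; exists m' => //; split => //.
  by rewrite take_takel.
split; first split.
- by move=> i; rewrite mxE eqxx orbT.
- by move=> i j; rewrite mxE => /orP[/low/ltnW //|/eqP ->].
- move=> i j k; rewrite !mxE => /orP[ji|/eqP -> //] /orP[kj|/eqP <-].
    by rewrite (trans i j).
  by rewrite ji.
- move=> i j k; rewrite !mxE [(k <= j)%N]leq_eqVlt.
  move=> Sij Sik /orP[/eqP/val_inj ->|kj]; first by rewrite eqxx orbT.
  case/orP: Sij => [ji|/eqP ij].
    case/orP: Sik => [ki|/eqP ik]; first by rewrite (chain i).
    by have := ltn_trans kj (low _ _ ji); rewrite ik ltnn.
  by subst j; exact: Sik.
Qed.

(** * The loops of incomplete Cholesky as a system of recurrences *)

Section Ichol.
Variables (R : realType) (n : nat) (A : 'M[R]_n) (T : 'M[bool]_n).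

(** The assigned expressions evaluated at an arbitrary matrix, so that the output of the loops can
    be characterised as a fixed point. *)
Definition ichol_entry (L : 'M[R]_n) (i j : 'I_n) : R :=
  if (j < i)%N then
    if T i j then (A i j - \sum_(k < n | (k < j)%N) L i k * L j k) / L j j
    else 0
  else if j == i then Num.sqrt (A i i - \sum_(k < n | (k < i)%N) L i k ^+ 2)
  else 0.

(** The invariant rule for both nested loops: the number of processed indices is also the next
    index. *)
Lemma foldl_take_ord (St : Type) (f : St -> 'I_n -> St) (P : nat -> St -> Prop)
    (z : St) (m : nat) :
  (m <= n)%N -> P 0%N z ->
  (forall (i : 'I_n) x, (i < m)%N -> P i x -> P i.+1 (f x i)) ->
  P m (foldl f z (take m (enum 'I_n))).
Proof.
move=> mn P0 PS; suff: forall k, (k <= m)%N ->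
  P k (foldl f z (take k (enum 'I_n))) by exact.
elim=> [|k IH] km; first by rewrite take0.
have kn : (k < n)%N by exact: leq_trans mn.
rewrite (take_nth (Ordinal kn)) ?size_enum_ord // -cats1 foldl_cat /=.
rewrite (_ : nth _ _ _ = Ordinal kn); last by apply: val_inj; rewrite /= nth_enum_ord.
by apply: (PS (Ordinal kn)) => //; apply: IH; exact: ltnW.
Qed.

Lemma enum_ord_lt (i : 'I_n) :
  [seq j : 'I_n <- enum 'I_n | (j < i)%N] = take i (enum 'I_n).
Proof.
apply: (inj_map val_inj); rewrite map_take val_enum_ord.
have -> : map val [seq j : 'I_n <- enum 'I_n | (j < i)%N] =
    [seq j <- map (@nat_of_ord n) (enum 'I_n) | (j < i)%N] by rewrite filter_map.
rewrite val_enum_ord.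
rewrite take_iota (minn_idPl (ltnW (ltn_ord i))).
have -> : iota 0 n = iota 0 i ++ iota i (n - i).
  by rewrite -[X in iota X (n - i)]add0n -iotaD subnKC // ltnW.
rewrite filter_cat.
rewrite (all_filterP _); last first.
  by apply/allP => j; rewrite mem_iota.
rewrite (eq_in_filter (a2 := pred0)) ?filter_pred0 ?cats0 //.
by move=> j; rewrite mem_iota => /andP[ij _]; rewrite ltnNge ij.
Qed.

(** An assignment at column j leaves intact everything that the recurrences of row i at columns up
    to j read, so an equation once established survives the rest of the row. The row must start at
    zero for the entries that are never assigned. *)
Lemma ichol_row_spec (L : 'M[R]_n) (i : 'I_n) :
  (forall b, L i b = 0) ->
  let L' := ichol_row A T L i in
  (forall a b, a != i -> L' a b = L a b) /\
  (forall b, L' i b = ichol_entry L' i b).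
Proof.
move=> Li0; rewrite /ichol_row enum_ord_lt.
set L1 := foldl _ _ _.
have [L1o L1lt L1ge] : [/\ forall a b, a != i -> L1 a b = L a b,
    forall b : 'I_n, (b < i)%N -> L1 i b = ichol_entry L1 i b
  & forall b : 'I_n, (i <= b)%N -> L1 i b = 0].
  pose P m (L1 : 'M[R]_n) := [/\ forall a b, a != i -> L1 a b = L a b,
    forall b : 'I_n, (b < m)%N -> L1 i b = ichol_entry L1 i b
  & forall b : 'I_n, (m <= b)%N -> L1 i b = 0].
  suff: P i L1 by []; apply: foldl_take_ord => [||j L2 ji [o lt ge]].
  - exact: ltnW.
  - by split.
  rewrite /ichol_offdiag; case: ifPn => Tij; split.
  - by move=> a b ai; rewrite mxE (negPf ai) /=; exact: o.
  - move=> b; rewrite ltnS leq_eqVlt => bj.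
    have bi : (b < i)%N by move: bj ji; lia.
    have E : ichol_entry (set_entry L2 i j ((A i j - \sum_(k < n | (k < j)%N)
        L2 i k * L2 j k) / L2 j j)) i b = ichol_entry L2 i b.
      rewrite /ichol_entry bi; case: ifP => // _; congr (_ / _).
        congr (_ - _); apply: eq_bigr => k kb.
        rewrite !mxE eqxx /= -!val_eqE /=.
        have -> : (k == j :> nat) = false by apply/negP; move/eqP; move: bj kb; lia.
        by have -> : (b == i :> nat) = false by apply/negP; move/eqP; lia.
      rewrite !mxE -!val_eqE /=.
      by have -> : (b == i :> nat) = false by apply/negP; move/eqP; lia.
    rewrite E mxE eqxx /=; case: eqP => [->|/eqP bj'].
      by rewrite /ichol_entry ji Tij.
    by apply: lt; case/orP: bj => // /eqP /val_inj e; rewrite e eqxx in bj'.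
  - move=> b jb; rewrite mxE eqxx /= ifF ?ge //; first exact: ltnW.
    by apply/negP => /eqP e; rewrite e ltnn in jb.
  - by [].
  - move=> b; rewrite ltnS leq_eqVlt => /orP[/eqP/val_inj ->|/lt //].
    by rewrite ge // /ichol_entry ji (negPf Tij).
  - by move=> b jb; apply: ge; exact: ltnW.
(* The diagonal entry is written last, and no recurrence of its own row reads it. *)
have E b : ichol_entry (ichol_diag A i L1) i b =
    if b == i then Num.sqrt (A i i - \sum_(k < n | (k < i)%N) L1 i k ^+ 2)
    else ichol_entry L1 i b.
  have ne (k : 'I_n) : (k < i)%N -> (k == i) = false.
    by move=> ki; apply/negP => /eqP e; rewrite e ltnn in ki.
  rewrite /ichol_entry; case: (ltnP b i) => bi.
    rewrite ne //; case: ifP => // _; rewrite !mxE ne //=; congr ((_ - _) / _).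
    apply: eq_bigr => k kb; rewrite !mxE eqxx /= !ne //.
    exact: ltn_trans bi.
  case: eqP => // _; congr (Num.sqrt (_ - _)).
  by apply: eq_bigr => k ki; rewrite !mxE eqxx ne.
split=> [a b ai|b]; first by rewrite mxE (negPf ai) /=; exact: L1o.
rewrite E mxE eqxx /=; case: eqP => // /eqP bi.
case: (ltnP b i) => [/L1lt //|ib]; rewrite L1ge // /ichol_entry.
by rewrite ltnNge ib /= (negPf bi).
Qed.

(** The recurrences of a row read only rows up to that one, and a finished row is never written
    again. *)
Lemma icholE i j : ichol A T i j = ichol_entry (ichol A T) i j.
Proof.
rewrite /ichol -{1 2}(take_size (enum 'I_n)) size_enum_ord.
set L := foldl _ _ _.
pose P m (L : 'M[R]_n) :=
  (forall i j : 'I_n, (i < m)%N -> L i j = ichol_entry L i j) /\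
  (forall i j : 'I_n, (m <= i)%N -> L i j = 0).
suff [-> //] : P n L by [].
rewrite {}/L {i j}; apply: foldl_take_ord => [//||i L _ [lt ge]].
  by split=> // i j _; rewrite mxE.
have [o e] := ichol_row_spec (fun b => ge i b (leqnn i)).
have ne (k : 'I_n) : (k < i)%N -> k != i.
  by move=> ki; apply/negP => /eqP e'; rewrite e' ltnn in ki.
split=> a b; last first.
  by move=> ia; rewrite o ?ge //; [exact: ltnW | rewrite neq_ltn ia orbT].
rewrite ltnS leq_eqVlt => /orP[/eqP/val_inj -> //|ai].
rewrite o ?ne // lt // /ichol_entry; case: ltnP => [ba|ab].
  case: ifP => // _; rewrite o ?ne //; last exact: ltn_trans ai.
  congr ((_ - _) / _); apply: eq_bigr => k kb.
  by rewrite !o ?ne //; exact: ltn_trans ai.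
case: ifP => // _; congr (Num.sqrt (_ - _)); apply: eq_bigr => k ka.
by rewrite o ?ne.
Qed.
End Ichol.

(** * Inverses of triangular matrices with an order pattern *)

Lemma lower_unitmx (R : fieldType) n (D : 'M[R]_n) :
  (forall i j : 'I_n, (i < j)%N -> D i j = 0) -> (forall i, D i i != 0) ->
  D \in unitmx.
Proof.
move=> low nz; rewrite unitmxE unitfE det_trig; last exact/is_trig_mxP.
by apply/prodf_neq0.
Qed.

Section Patterned.
Variables (R : fieldType) (n : nat) (T : 'M[bool]_n) (D : 'M[R]_n).
Hypotheses (Tpat : order_pattern T) (DT : patterned T D).

Lemma patterned_low (i j : 'I_n) : (i < j)%N -> D i j = 0.
Proof.
by move=> ij; apply: DT; apply: contraTN ij => /(pat_low Tpat); rewrite -leqNgt.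
Qed.

Hypothesis nz : forall i, D i i != 0.

Lemma patterned_unitmx : D \in unitmx.
Proof. exact: lower_unitmx patterned_low nz. Qed.

(** Induction on the row. In entry (i, j) of D D^{-1} = 1, a term with k <> i and [T i k] has k < i,
    and [T k j] would give [T i j] by transitivity; so the term vanishes by induction, and only
    D_{ii} times the wanted entry remains. *)
Lemma invmx_patterned : patterned T (invmx D).
Proof.
move=> i; have [m] := ubnP (val i); elim: m i => // m IH i /ltnSE im j nT.
have := mulmxV patterned_unitmx => /matrixP/(_ i j); rewrite !mxE (bigD1 i) //=.
have -> : (i == j) = false.
  by apply: contraNF nT => /eqP <-; exact: (pat_refl Tpat).
rewrite big1 ?addr0 => [/eqP|k ki].
  by rewrite mulf_eq0 (negPf (nz i)) => /eqP.
have [Tik|/DT ->] := boolP (T i k); last by rewrite mul0r.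
rewrite (IH k) ?mulr0 //.
  by apply: leq_trans im; rewrite ltn_neqAle ki (pat_low Tpat).
by apply: contraNN nT; exact: (pat_trans Tpat) Tik.
Qed.

(** Forward substitution in which only chains i -> k -> j of the order survive; this is what makes
    steps 2 and 5 cheap. *)
Lemma invmx_row (i j : 'I_n) : T i j ->
  invmx D i j =
  ((i == j)%:R - \sum_(k < n | [&& T i k, T k j & (k < i)%N]) D i k * invmx D k j)
  / D i i.
Proof.
move=> Tij; have := mulmxV patterned_unitmx => /matrixP/(_ i j).
rewrite !mxE (bigD1 i) //= => <-.
rewrite (bigID (fun k => [&& T i k, T k j & (k < i)%N]) (fun k => k != i)) /=.
rewrite [X in _ + (_ + X) - _]big1 => [|k /andP[ki]].
  rewrite addr0 (eq_bigl (fun k => [&& T i k, T k j & (k < i)%N])).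
    by rewrite addrK mulrC mulKf.
  move=> k; case: (ltnP k i) => [ki|]; last by rewrite !andbF.
  by rewrite neq_ltn ki.
have [Tik|/DT -> _] := boolP (T i k); last by rewrite mul0r.
have [Tkj|/invmx_patterned -> _] := boolP (T k j); last by rewrite mulr0.
by rewrite ltn_neqAle ki (pat_low Tpat Tik).
Qed.

End Patterned.

(** * Positive pivots and exactness of the factor on its pattern *)

Section IcholFactor.
Variables (R : realType) (n : nat) (A : 'M[R]_n) (T : 'M[bool]_n).
Hypotheses (Tpat : order_pattern T) (Apd : posdefmx A).
Let L := ichol A T.

Lemma ichol_patterned : patterned T L.
Proof.
move=> i j nT; rewrite /L icholE /ichol_entry (negPf nT); case: ifP => // _.
by case: eqP nT => // ->; rewrite (pat_refl Tpat).
Qed.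

Lemma ichol_mul_off (i j : 'I_n) : T i j -> (j < i)%N -> L j j != 0 ->
  \sum_k L i k * L j k = A i j.
Proof.
move=> Tij ji nz; rewrite (bigID (fun k : 'I_n => (k < j)%N)) /= addrC.
rewrite (bigD1 j) ?ltnn //= big1 ?addr0 => [|k /andP[jk kj]].
  rewrite {1}/L icholE /ichol_entry ji Tij -/L divfK //.
  by rewrite subrK.
rewrite [L j k](patterned_low Tpat) ?mulr0 //; first exact: ichol_patterned.
by rewrite ltn_neqAle eq_sym kj leqNgt.
Qed.

(** [Num.sqrt] vanishes on negative numbers, so a positive pivot certifies a positive radicand,
    which squaring recovers. *)
Lemma ichol_mul_diag (i : 'I_n) : 0 < L i i -> \sum_k L i k * L i k = A i i.
Proof.
move=> pos; rewrite (bigID (fun k : 'I_n => (k < i)%N)) /= addrC.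
rewrite (bigD1 i) ?ltnn //= big1 ?addr0 => [|k /andP[ik ki]].
  have E : L i i = Num.sqrt (A i i - \sum_(k < n | (k < i)%N) L i k ^+ 2).
    by rewrite /L icholE /ichol_entry ltnn eqxx.
  rewrite {1 2}E -expr2 sqr_sqrtr; first by rewrite subrK.
  by rewrite ltW // -sqrtr_gt0 -E.
rewrite [L i k](patterned_low Tpat) ?mulr0 //; first exact: ichol_patterned.
by rewrite ltn_neqAle eq_sym ki leqNgt.
Qed.

(* No fill-in: any two indices of a row of T are comparable, or are decoupled
   both in A and in the factor. *)
Hypothesis nofill : forall i a b, T i a -> T i b ->
  [\/ T a b, T b a | A a b = 0 /\ forall k, ~~ (T a k && T b k)].

(** Symmetry of [A] reduces a comparable pair to the lower triangle, where the recurrence is the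
    identity; a decoupled pair gives 0 on both sides. The pair (i, i) is excluded because the
    positivity of that pivot is what this lemma serves to prove. *)
Lemma ichol_mul_upto (i a b : 'I_n) :
  (forall c : 'I_n, (c < i)%N -> 0 < L c c) -> T i a -> T i b ->
  (a != i) || (b != i) -> \sum_k L a k * L b k = A a b.
Proof.
move=> pos; wlog: a b / (T a b) => [W Ta Tb ne|Tab Ta Tb ne].
  case: (nofill Ta Tb) => [Tab|Tba|[A0 nT]]; first exact: W.
    have [As _] := Apd; rewrite -As mxE -W ?[(b != i) || _]orbC //.
    by apply: eq_bigr => k _; rewrite mulrC.
  rewrite A0 big1 // => k _; have := nT k; rewrite negb_and.
  by case/orP => /ichol_patterned ->; rewrite ?mul0r ?mulr0.
have := pat_low Tpat Tab; rewrite leq_eqVlt; case/orP=> [/eqP/val_inj ba|ba].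
  subst b; apply: ichol_mul_diag; apply: pos.
  by rewrite ltn_neqAle (pat_low Tpat) // andbT; case/orP: ne.
apply: ichol_mul_off => //; rewrite gt_eqF // pos //.
exact: leq_trans ba (pat_low Tpat Ta).
Qed.

(* The pivot at i is the value of the quadratic form of A at row i of the
   inverse of the factor computed so far, with the pivot replaced by 1. *)
Lemma ichol_diag_gt0 i : 0 < L i i.
Proof.
have [m] := ubnP (val i); elim: m i => // m IH i /ltnSE im.
have pos (c : 'I_n) : (c < i)%N -> 0 < L c c.
  by move=> ci; apply: IH; exact: leq_trans im.
pose d := A i i - \sum_(k < n | (k < i)%N) L i k ^+ 2.
suff d0 : 0 < d by rewrite /L icholE /ichol_entry ltnn eqxx -/L sqrtr_gt0.
(* Rows after i are those of the identity, so that invertibility of [D] rests only on the pivots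
   before i. *)
pose D : 'M[R]_n := \matrix_(a, b)
  if (a < i)%N then L a b
  else if (a == i) && (b < i)%N then L a b else (a == b)%:R.
have DT : patterned T D.
  move=> a b nT; rewrite mxE ichol_patterned //.
  have -> : (a == b) = false.
    by apply: contraNF nT => /eqP ->; exact: (pat_refl Tpat).
  by rewrite !if_same.
have Dnz a : D a a != 0.
  rewrite mxE eqxx; case: ltnP => [ai|ia]; first by rewrite gt_eqF // pos.
  by rewrite andbF oner_neq0.
have Dunit := patterned_unitmx Tpat DT Dnz.
pose v : 'rV[R]_n := row i (invmx D).
have vD : v *m D = row i 1%:M by rewrite -row_mul mulVmx.
have vT a : ~~ T i a -> v 0 a = 0.
  by move=> nT; rewrite mxE (invmx_patterned Tpat DT Dnz).
pose E : 'M[R]_n := diag_mx (\row_k if k == i then d else 1).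
(* Agreement is claimed only on the support of [v]; elsewhere [A] and D E D^T may differ. *)
have AE a b : T i a -> T i b -> A a b = (D *m E *m D^T) a b.
  move=> Ta Tb; have ai := pat_low Tpat Ta; have bi := pat_low Tpat Tb.
  have Llow := patterned_low Tpat ichol_patterned.
  have -> : (D *m E *m D^T) a b =
      \sum_k (if k == i then d else 1) * (D a k * D b k).
    rewrite mxE; apply: eq_bigr => k _; rewrite mul_mx_diag !mxE.
    by rewrite mulrAC mulrC.
  have Dlt (c k : 'I_n) : (c < i)%N -> D c k = L c k by move=> ci; rewrite mxE ci.
  have Di (k : 'I_n) : (k < i)%N -> D i k = L i k by move=> ki; rewrite mxE ltnn eqxx ki.
  have [/andP[/eqP -> /eqP ->]|] := boolP ((a == i) && (b == i)).
    rewrite (bigID (fun k : 'I_n => (k < i)%N)) /= addrC.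
    rewrite (bigD1 i) ?ltnn //= big1 ?addr0 => [|k /andP[ik ki]].
      rewrite eqxx mxE ltnn eqxx /= !mulr1 /d.
      rewrite -[LHS](subrK (\sum_(k < n | (k < i)%N) L i k ^+ 2)).
      congr (_ + _); apply: eq_bigr => k ki; rewrite Di // -expr2.
      by rewrite ifF ?mul1r //; apply: contraTF ki => /eqP ->; rewrite ltnn.
    rewrite [D i k](patterned_low Tpat DT) ?mulr0 //.
    by rewrite ltn_neqAle eq_sym ki leqNgt.
  rewrite negb_and => ne; rewrite -(ichol_mul_upto pos Ta Tb ne).
  apply: eq_bigr => k _; have [ki|ik] := ltnP k i.
    have -> : (k == i) = false by apply: contraTF ki => /eqP ->; rewrite ltnn.
    rewrite mul1r; congr (_ * _).
      by move: ai; rewrite leq_eqVlt => /orP[/eqP/val_inj ->|/Dlt->]; rewrite ?Di.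
    by move: bi; rewrite leq_eqVlt => /orP[/eqP/val_inj ->|/Dlt->]; rewrite ?Di.
  case/orP: ne => ne.
    have ai' : (a < i)%N by rewrite ltn_neqAle ne ai.
    by rewrite Dlt // Llow ?mul0r ?mulr0 //; exact: leq_trans ik.
  have bi' : (b < i)%N by rewrite ltn_neqAle ne bi.
  by rewrite [D b k]Dlt // [L b k]Llow ?mulr0 //; exact: leq_trans ik.
have quad (B : 'M[R]_n) : (v *m B *m v^T) 0 0 = \sum_a \sum_b v 0 a * B a b * v 0 b.
  rewrite mxE exchange_big /=; apply: eq_bigr => b _; rewrite mxE big_distrl /=.
  by apply: eq_bigr => a _; rewrite [v^T _ _]mxE.
have [_ /(_ v^T)] := Apd; rewrite trmxK.
have -> : (v *m A *m v^T) 0 0 = (v *m (D *m E *m D^T) *m v^T) 0 0.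
  rewrite !quad; apply: eq_bigr => a _; apply: eq_bigr => b _.
  have [Ta|/vT ->] := boolP (T i a); last by rewrite !mul0r.
  have [Tb|/vT ->] := boolP (T i b); last by rewrite !mulr0.
  by rewrite AE.
have -> : v *m (D *m E *m D^T) *m v^T = (v *m D) *m E *m (v *m D)^T.
  by rewrite trmx_mul !mulmxA.
rewrite vD => P; have : (row i 1%:M *m E *m (row i 1%:M)^T) 0 0 = d :> R.
  rewrite mxE (bigD1 i) //= big1 => [|k ki].
    by rewrite mul_mx_diag !mxE eqxx mul1r mulr1 addr0.
  by rewrite [_^T _ _]mxE !mxE eq_sym (negPf ki) mulr0.
(* It remains that [v] is nonzero: otherwise [v *m D], the i-th unit row, would vanish. *)
move=> <-; apply: P; apply/eqP => /(congr1 trmx); rewrite trmxK trmx0 => v0.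
have := vD; rewrite v0 mul0mx => /rowP/(_ i)/eqP; rewrite !mxE eqxx.
by rewrite eq_sym oner_eq0.
Qed.

Lemma ichol_mul a b : T a b -> (L *m L^T) a b = A a b.
Proof.
move=> Tab; have -> : (L *m L^T) a b = \sum_k L a k * L b k.
  by rewrite mxE; apply: eq_bigr => k _; rewrite [L^T _ _]mxE.
have := pat_low Tpat Tab; rewrite leq_eqVlt; case/orP=> [/eqP/val_inj ->|ba].
  by apply: ichol_mul_diag; exact: ichol_diag_gt0.
by apply: ichol_mul_off => //; rewrite gt_eqF // ichol_diag_gt0.
Qed.

End IcholFactor.

(** * Sparsity of the prior and posterior factors *)

Section Posterior.
Variables (R : realType) (n : nat) (S : 'M[bool]_n).
Hypotheses (Spat : order_pattern S).
Hypothesis Schain : forall i j k, S i j -> S i k -> (k <= j)%N -> S j k.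

Lemma pattern_comparable i j k : S i j -> S i k -> S j k \/ S k j.
Proof.
move=> Sij Sik; case/orP: (leq_total k j) => ?.
  by left; exact: Schain Sij Sik _.
by right; exact: Schain Sik Sij _.
Qed.

Section Prior.
Variable Sigma : 'M[R]_n.
Hypothesis Sigma_pd : posdefmx Sigma.
Let L := ichol Sigma S.

(** The ancestors of one node form a chain, so for the prior the decoupled alternative never
    arises. *)
Lemma pattern_nofill i a b : S i a -> S i b ->
  [\/ S a b, S b a | Sigma a b = 0 /\ forall k, ~~ (S a k && S b k)].
Proof.
by move=> Sa Sb; case: (pattern_comparable Sa Sb) => ?; [constructor 1|constructor 2].
Qed.

Lemma prior_diag_gt0 i : 0 < L i i.
Proof. exact: ichol_diag_gt0 pattern_nofill i. Qed.

Lemma prior_diag_neq0 i : L i i != 0.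
Proof. by rewrite gt_eqF // prior_diag_gt0. Qed.

Lemma prior_unitmx : L \in unitmx.
Proof.
exact: patterned_unitmx Spat (ichol_patterned _ Spat) prior_diag_neq0.
Qed.

Lemma prior_invmx_patterned : patterned S (invmx L).
Proof.
exact: invmx_patterned Spat (ichol_patterned _ Spat) prior_diag_neq0.
Qed.

End Prior.

(** The quadratic form is |F^T v|^2 + \sum_k w_k (G v)_k^2: the first summand is positive by
    injectivity, the second nonnegative. *)
Lemma posdefmx_sum m1 m2 (F : 'M[R]_(n, m1)) (G : 'M[R]_(m2, n)) (w : 'rV[R]_m2) :
  (forall v : 'cV[R]_n, v != 0 -> F^T *m v != 0) -> (forall a, 0 <= w 0 a) ->
  posdefmx (F *m F^T + G^T *m diag_mx w *m G).
Proof.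
move=> Finj w0; split.
  by rewrite linearD /= !trmx_mul !trmxK tr_diag_mx mulmxA.
move=> v v0; rewrite mulmxDr mulmxDl mxE ltr_pwDl //.
  have -> : v^T *m (F *m F^T) *m v = (F^T *m v)^T *m (F^T *m v).
    by rewrite trmx_mul trmxK !mulmxA.
  have /matrix0Pn [i [j]] := Finj v v0; rewrite (ord1 j).
  move: (F^T *m v) => u ui; rewrite mxE (bigD1 i) //= [u^T _ _]mxE -expr2.
  rewrite ltr_pwDl ?exprn_even_gt0 //.
  by apply: sumr_ge0 => k _; rewrite [u^T _ _]mxE -expr2 sqr_ge0.
have -> : v^T *m (G^T *m diag_mx w *m G) *m v =
    (G *m v)^T *m diag_mx w *m (G *m v) by rewrite trmx_mul !mulmxA.
move: (G *m v) => u; rewrite mxE; apply: sumr_ge0 => k _.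
rewrite mul_mx_diag !mxE mulrAC -expr2.
by rewrite mulr_ge0 ?sqr_ge0.
Qed.

Lemma trmx_revmx : revmx^T = revmx :> 'M[R]_n.
Proof.
by apply/matrixP => i j; rewrite !mxE -(inj_eq rev_ord_inj) rev_ordK eq_sym.
Qed.

Lemma revmx_mul_mul (A : 'M[R]_n) i j :
  (revmx *m A *m revmx) i j = A (rev_ord i) (rev_ord j).
Proof.
rewrite mxE (bigD1 (rev_ord j)) //= big1 => [|k kj].
  rewrite addr0 [revmx _ j]mxE rev_ordK eqxx mulr1 mxE (bigD1 (rev_ord i)) //=.
  rewrite big1 => [|k ki]; first by rewrite addr0 mxE eqxx mul1r.
  by rewrite mxE (negPf ki) mul0r.
rewrite [revmx _ j]mxE -(inj_eq rev_ord_inj) rev_ordK.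
by rewrite eq_sym (negPf kj) mulr0.
Qed.

Lemma revmxK : revmx *m revmx = 1%:M :> 'M[R]_n.
Proof.
rewrite -[X in X *m _]mulmx1; apply/matrixP => i j.
by rewrite revmx_mul_mul !mxE (inj_eq rev_ord_inj).
Qed.

Lemma posdefmx_rev (A : 'M[R]_n) : posdefmx A -> posdefmx (revmx *m A *m revmx).
Proof.
move=> [As Ap]; split=> [|v v0]; first by rewrite !trmx_mul As trmx_revmx mulmxA.
have -> : v^T *m (revmx *m A *m revmx) *m v = (revmx *m v)^T *m A *m (revmx *m v).
  by rewrite trmx_mul trmx_revmx !mulmxA.
apply: Ap; apply: contra v0 => /eqP e.
by rewrite -[v]mul1mx -revmxK -mulmxA e mulmx0.
Qed.

(** Reversal alone would give an upper triangular pattern; the transposition makes it lower again.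
    Row i now lists the descendants of [rev_ord i]. *)
Definition revpattern : 'M[bool]_n := \matrix_(i, j) S (rev_ord j) (rev_ord i).

Lemma revpattern_order : order_pattern revpattern.
Proof.
split=> [i|i j|i j k]; rewrite !mxE; first exact: (pat_refl Spat).
  by move=> /(pat_low Spat) /=; have := ltn_ord i; have := ltn_ord j; lia.
by move=> ij jk; exact: (pat_trans Spat) jk ij.
Qed.

Section RevChol.
Variable Lam : 'M[R]_n.
Hypothesis Lam_pd : posdefmx Lam.
Hypothesis Lam0 : forall i j, ~~ S i j -> ~~ S j i -> Lam i j = 0.

Let A := revmx *m Lam *m revmx.
Definition revchol : 'M[R]_n := ichol A revpattern.

(** Incomparable nodes have no common descendant, because any two ancestors of a node are
    comparable. *)
Lemma revchol_nofill a b : 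
  [\/ revpattern a b, revpattern b a |
      A a b = 0 /\ forall k, ~~ (revpattern a k && revpattern b k)].
Proof.
rewrite !mxE; case: (boolP (S (rev_ord b) (rev_ord a))) => [|nba].
  by constructor 1.
case: (boolP (S (rev_ord a) (rev_ord b))) => [|nab]; first by constructor 2.
constructor 3; split; first by have := revmx_mul_mul Lam a b; rewrite mxE Lam0.
move=> k; rewrite !mxE; apply/negP => /andP[ka kb].
by case: (pattern_comparable ka kb) => e; rewrite e in nab nba.
Qed.

(** [ichol_mul] gives exactness on the pattern and symmetry extends it to the transposed pattern. At
    the remaining pairs both the matrix and the product vanish, so the incomplete factor is the
    complete one. *)
Lemma revchol_is_chol : is_chol A revchol.
Proof.
have nofill i a b : revpattern i a -> revpattern i b ->
  [\/ revpattern a b, revpattern b a |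
      A a b = 0 /\ forall k, ~~ (revpattern a k && revpattern b k)].
  by move=> _ _; exact: revchol_nofill.
have A_pd : posdefmx A by exact: posdefmx_rev.
have Bpat := ichol_patterned A revpattern_order.
have mulE := ichol_mul revpattern_order A_pd nofill.
split=> [i j|i|]; first exact: (patterned_low revpattern_order Bpat).
  exact: (ichol_diag_gt0 revpattern_order A_pd nofill).
apply/matrixP => a b; have [|Tba|[A0 nT]] := revchol_nofill a b; first exact: mulE.
  have [As _] := A_pd; have -> : A a b = A b a by rewrite -[in LHS]As mxE.
  rewrite -mulE // !mxE; apply: eq_bigr => k _.
  by rewrite mulrC ![_^T _ _]mxE.
rewrite A0 mxE big1 // => k _; rewrite [_^T _ _]mxE; have := nT k.
by rewrite negb_and => /orP[] /Bpat ->; rewrite ?mul0r ?mulr0.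
Qed.

Let Ut := revmx *m revchol *m revmx.

Lemma revchol_patterned : patterned S Ut^T.
Proof.
move=> i j nS; rewrite mxE revmx_mul_mul (ichol_patterned _ revpattern_order) //.
by rewrite mxE !rev_ordK.
Qed.

Lemma revchol_diag_gt0 i : 0 < Ut i i.
Proof. by rewrite revmx_mul_mul; have [_ + _] := revchol_is_chol; exact. Qed.

Lemma revchol_mul : Ut *m Ut^T = Lam.
Proof.
have [_ _ BB] := revchol_is_chol.
rewrite /Ut !trmx_mul trmx_revmx !mulmxA -[_ *m revmx *m revmx]mulmxA revmxK mulmx1.
rewrite -[revmx *m _ *m _]mulmxA BB /A !mulmxA revmxK mul1mx.
by rewrite -mulmxA revmxK mulmx1.
Qed.

(** Entry (i, j) of Ut Ut^T = Lam: row i of [Ut] is supported on the descendants of i, and the term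
    k = i is isolated. For i = j the right-hand side is a square, so one identity serves both the
    root and the quotient. *)
Lemma revchol_entry (i j : 'I_n) : S i j ->
  Lam i j - \sum_(k < n | S k i && (i < k)%N) Ut j k * Ut i k = Ut j i * Ut i i.
Proof.
move=> Sij; rewrite -revchol_mul.
have -> : (Ut *m Ut^T) i j = \sum_k Ut j k * Ut i k.
  by rewrite mxE; apply: eq_bigr => k _; rewrite [_^T _ _]mxE mulrC.
rewrite (bigD1 i) //= (bigID (fun k => S k i && (i < k)%N) (fun k => k != i)) /=.
rewrite [X in _ + (_ + X) - _]big1 => [|k /andP[ki]].
  rewrite addr0 (eq_bigl (fun k => S k i && (i < k)%N)) ?addrK //.
  move=> k; case: (ltnP i k) => [ik|]; last by rewrite !andbF.
  by rewrite neq_ltn ik orbT.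
have [Ski|nS _] := boolP (S k i).
  by rewrite ltn_neqAle eq_sym ki (pat_low Spat Ski).
by have /revchol_patterned := nS; rewrite mxE => ->; rewrite mulr0.
Qed.

End RevChol.
End Posterior.

(** * Straight-line evaluation of cells in dependency order *)

Section Machine.
Variable cell : finType.

Inductive start := Const of bool | Copy of cell.
Inductive finish := Keep | Root | Quot of cell.

(* Every number of the algorithm is a start value plus or minus a sum of
   products, possibly followed by a square root or a division. *)
Record task := Task {
  t_start : start; t_sub : bool; t_terms : seq (cell * cell); t_finish : finish }.

(* A scratch location per cell, rather than a single one, keeps the memory
   empty when n = 0. *)
Definition machine_size : nat := #|{: cell * bool}|.
Definition loc (x : cell) : 'I_machine_size := enum_rank (x, false).
Definition scratch (x : cell) : 'I_machine_size := enum_rank (x, true).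

Definition start_code x o : instr machine_size :=
  match o with Const b => IConst (loc x) b | Copy y => ICopy (loc x) (loc y) end.

Definition term_code x (sub : bool) (ab : cell * cell) : program machine_size :=
  [:: IMul (scratch x) (loc ab.1) (loc ab.2);
      (if sub then @ISub _ else @IAdd _) (loc x) (loc x) (scratch x)].

Definition finish_code x f : program machine_size :=
  match f with
  | Keep => [::] | Root => [:: ISqrt (loc x) (loc x)]
  | Quot y => [:: IDiv (loc x) (loc x) (loc y)] end.

Definition task_code x t : program machine_size :=
  start_code x (t_start t) ::
  flatten [seq term_code x (t_sub t) ab | ab <- t_terms t] ++
  finish_code x (t_finish t).

Definition reads t : seq cell :=
  (if t_start t is Copy y then [:: y] else [::]) ++
  flatten [seq [:: ab.1; ab.2] | ab <- t_terms t] ++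
  (if t_finish t is Quot y then [:: y] else [::]).

Lemma size_task_code x t : (size (task_code x t) <= 2 + 2 * size (t_terms t))%N.
Proof.
rewrite /task_code /= size_cat.
have -> : size (flatten [seq term_code x (t_sub t) ab | ab <- t_terms t]) =
    (2 * size (t_terms t))%N.
  by elim: (t_terms t) => //= ab l ->; rewrite mulnS.
by case: (t_finish t) => //=; lia.
Qed.

Variable R : realType.
Implicit Types (v : cell -> R) (m : memory R machine_size).

Definition start_val v o := match o with Const b => b%:R | Copy y => v y end.

Definition task_sum v t : R :=
  start_val v (t_start t) +
  (-1) ^+ t_sub t * \sum_(ab <- t_terms t) v ab.1 * v ab.2.

Definition finish_val v f (x : R) : option R :=
  match f with
  | Keep => Some x
  | Root => if x < 0 then None else Some (Num.sqrt x)
  | Quot y => if v y == 0 then None else Some (x / v y) end.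

Definition task_val v t : option R := finish_val v (t_finish t) (task_sum v t).

Lemma exec_cat s (p q : program s) (m : memory R s) :
  exec (p ++ q) m = obind (exec q) (exec p m).
Proof. by elim: p m => //= i p IH m; case: exec_instr => //=. Qed.

(** [v] is a static valuation giving each cell its final value; [P] selects the cells that already
    hold theirs. *)
Definition agree (P : pred cell) m v := forall x, P x -> m (loc x) = v x.

(** The running sum is kept in the cell of [x] itself, so the operands must be other cells. The
    products go to a scratch location, which no [loc] reaches. *)
Lemma exec_terms x sub l m v a :
  (forall y, y \in flatten [seq [:: ab.1; ab.2] | ab <- l] ->
     y != x /\ m (loc y) = v y) ->
  m (loc x) = a ->
  exists m', [/\ exec (flatten [seq term_code x sub ab | ab <- l]) m = Some m',
    m' (loc x) = a + (-1) ^+ sub * \sum_(ab <- l) v ab.1 * v ab.2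
    & forall y, y != x -> m' (loc y) = m (loc y)].
Proof.
elim: l m a => [|[y z] l IH] m a lv mx.
  by exists m; split=> //; rewrite big_nil mulr0 addr0.
have [/= yx yv] := lv y (mem_head _ _).
have [|/= zx zv] := lv z; first by rewrite !inE eqxx orbT.
pose m1 := write (write m (scratch x) (v y * v z)) (loc x)
  (a + (-1) ^+ sub * (v y * v z)).
have m1o w : w != x -> m1 (loc w) = m (loc w).
  by move=> wx; rewrite /m1 /write !(inj_eq enum_rank_inj) !xpair_eqE (negPf wx).
have [||m' [em' m'x m'o]] := IH m1 (a + (-1) ^+ sub * (v y * v z)).
- move=> w wl; have [|wx wv] := lv w; first by rewrite !inE wl !orbT.
  by rewrite m1o.
- by rewrite /m1 /write eqxx.
exists m'; split=> [||w wx]; last by rewrite m'o ?m1o.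
  rewrite /= -em' yv zv; have sx : (loc x == scratch x) = false.
    by rewrite (inj_eq enum_rank_inj) xpair_eqE andbF.
  by rewrite /m1; case: (sub); rewrite /= /write eqxx sx mx
     ?expr1 ?mulN1r ?expr0 ?mul1r.
by rewrite m'x big_cons mulrDr addrA.
Qed.

Lemma exec_finish x f m v a w :
  (forall y, f = Quot y -> y != x /\ m (loc y) = v y) ->
  m (loc x) = a -> finish_val v f a = Some w ->
  exists m', [/\ exec (finish_code x f) m = Some m', m' (loc x) = w
    & forall y, y != x -> m' (loc y) = m (loc y)].
Proof.
have wo b y : y != x -> write m (loc x) b (loc y) = m (loc y).
  by move=> yx; rewrite /write (inj_eq enum_rank_inj) xpair_eqE (negPf yx).
case: f => [||y] /= rd ma.
- by case=> <-; exists m.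
- case: ifP => //; rewrite ma => -> [<-].
  exists (write m (loc x) (Num.sqrt a)); split=> // [|y].
    by rewrite /write eqxx.
  exact: wo.
- have [yx yv] := rd y erefl; rewrite -yv; case: ifP => // _ [<-]; rewrite ma.
  exists (write m (loc x) (a / m (loc y))); split=> // [|z].
    by rewrite /write eqxx.
  exact: wo.
Qed.

Lemma exec_task x t m v w :
  (forall y, y \in reads t -> y != x /\ m (loc y) = v y) ->
  task_val v t = Some w ->
  exists m', [/\ exec (task_code x t) m = Some m', m' (loc x) = w
    & forall y, y != x -> m' (loc y) = m (loc y)].
Proof.
move=> rd tv; rewrite /task_code /=.
pose m1 := write m (loc x) (start_val v (t_start t)).
have e1 : exec_instr (start_code x (t_start t)) m = Some m1.
  rewrite /m1; case E : (t_start t) => [b|y] //=.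
  by have [|_ ->] := rd y; rewrite // /reads E inE eqxx.
have m1o y : y != x -> m1 (loc y) = m (loc y).
  by move=> yx; rewrite /m1 /write (inj_eq enum_rank_inj) xpair_eqE (negPf yx).
have [||m2 [e2 m2x m2o]] := @exec_terms x (t_sub t) (t_terms t) m1 v
  (start_val v (t_start t)).
- move=> y yl; have [|yx yv] := rd y; first by rewrite /reads !mem_cat yl orbT.
  by rewrite m1o.
- by rewrite /m1 /write eqxx.
have [y yf|m3 [e3 m3x m3o]] := exec_finish (x := x) (m := m2) _ m2x tv.
  have [|yx yv] := rd y; first by rewrite /reads yf !mem_cat inE eqxx !orbT.
  by rewrite m2o ?m1o.
exists m3; rewrite e1 /= exec_cat e2 /= e3; split=> // y yx.
by rewrite m3o ?m2o ?m1o.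
Qed.

Variables (todo : cell -> task) (stage rank : cell -> nat).
Hypothesis reads_before : forall x y, (0 < stage x)%N -> y \in reads (todo x) ->
  (stage y < stage x)%N || (stage y == stage x) && (rank y < rank x)%N.

Definition compile (l : seq cell) : program machine_size :=
  flatten [seq task_code x (todo x) | x <- l].

Lemma size_compile l :
  (size (compile l) <= 2 * size l + 2 * \sum_(x <- l) size (t_terms (todo x)))%N.
Proof.
elim: l => [|x l IH]; first by rewrite big_nil.
rewrite -[compile (x :: l)]/(task_code x (todo x) ++ compile l) size_cat big_cons.
have := size_task_code x (todo x); rewrite [size (x :: l)]/=.
by move: IH; lia.
Qed.

(** Earlier stages are complete, and sorting by [rank] puts the operands from the same stage ahead
    of each task, so every task reads final values only. *)
Lemma exec_compile l m v (k : nat) :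
  (0 < k)%N -> sorted (relpre rank leq) l -> (forall x, (x \in l) = (stage x == k)) ->
  (forall x, x \in l -> task_val v (todo x) = Some (v x)) ->
  agree (fun x => stage x < k)%N m v ->
  exists2 m', exec (compile l) m = Some m' & agree (fun x => stage x <= k)%N m' v.
Proof.
move=> k0 srt lE val mv.
(* Generalised for the induction: [P] grows by one cell per task, and the cells of stage k outside
   [P] are those still in the list. *)
suff: forall (P : pred cell), (forall x, (stage x < k)%N -> P x) ->
    (forall x, x \in l -> stage x == k) ->
    (forall x, stage x == k -> P x || (x \in l)) ->
    agree P m v ->
    exists2 m', exec (compile l) m = Some m' & agree (fun x => P x || (x \in l)) m' v.
  move=> /(_ (fun x => stage x < k)%N); case=> // [x|x|m' em' m'v].
  - by rewrite lE.
  - by rewrite lE orbC => ->.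
  - exists m' => // x; rewrite leq_eqVlt => xk; apply: m'v; rewrite lE.
    by rewrite orbC.
elim: l srt val m {lE mv} => [|x l IH] srt val m P Plt lk kP mP.
  by exists m => // x; rewrite orbF; exact: mP.
have xk := lk x (mem_head _ _).
have [y yx|m1 [e1 m1x m1o]] :=
  exec_task (x := x) (m := m) (v := v) _ (val x (mem_head _ _)).
  have st : (0 < stage x)%N by rewrite (eqP xk).
  have Py : P y && (y != x).
    have := reads_before st yx; rewrite (eqP xk).
    case/orP=> [yk|/andP[/eqP yk yr]].
      rewrite Plt //; apply: contraTN yk => /eqP ->.
      by rewrite (eqP xk) ltnn.
    have yx' : y != x by apply: contraTN yr => /eqP ->; rewrite ltnn.
    rewrite yx' andbT; have := kP y; rewrite yk eqxx inE (negPf yx') /= => /(_ isT).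
    (* An operand still waiting in the list would, by sortedness, have rank at least that of [x]. *)
    case/orP=> // yl; move: srt; rewrite /= (path_sortedE); last first.
      by move=> a b c /=; exact: leq_trans.
    by case/andP=> /allP/(_ y yl) /=; rewrite leqNgt yr.
  by case/andP: Py => Py yx'; split=> //; exact: mP.
have val' y : y \in l -> task_val v (todo y) = Some (v y).
  by move=> yl; apply: val; rewrite inE yl orbT.
have [||||m2 e2 m2v] :=
  IH (path_sorted srt) val' m1 (fun y => P y || (y == x)).
- by move=> y /Plt ->.
- by move=> y yl; apply: lk; rewrite inE yl orbT.
- by move=> y yk; have := kP y yk; rewrite inE orbA.
- move=> y /orP[Py|/eqP -> //]; have [->//|yx] := eqVneq y x.
  by rewrite m1o // mP.
exists m2; first by
  rewrite -[compile _]/(task_code x (todo x) ++ compile l) exec_cat e1.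
by move=> y; rewrite inE orbA; exact: m2v.
Qed.

End Machine.

(** * The program *)

Section HVProgram.
Variables (n : nat) (S : 'M[bool]_n) (I : {set 'I_n}).

Let pat := {p : 'I_n * 'I_n | S p.1 p.2}.

(* All matrices are indexed by the lower pattern S: [CLinv] holds U^T, and
   [CUt] the transpose of the upper triangular factor of Lambda. [CGain],
   [CRes] and [CProj] hold the diagonal of H^T R^-1 H, the vector
   r = H^T R^-1 (y - H mu), and Lt^T r. *)
Variant hv_cell : Type :=
| CSigma of pat | CL of pat | CLinv of pat | CLam of pat | CUt of pat | CLt of pat
| CMu of 'I_n | CGain of 'I_n | CRes of 'I_n | CProj of 'I_n | CMut of 'I_n
| CY of 'I_#|I| | CH of 'I_#|I| | CV of 'I_#|I|.

(** A tagged sum through which the cells inherit a finite type structure and a bound on their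
    number. *)
Definition hv_code : Type := ('I_6 * pat + 'I_5 * 'I_n + 'I_3 * 'I_#|I|)%type.

Definition hv_encode (x : hv_cell) : hv_code :=
  let m k p := inl (inl (inord k, p)) in
  let w k i := inl (inr (inord k, i)) in
  let o k a := inr (inord k, a) in
  match x with
  | CSigma p => m 0 p | CL p => m 1 p | CLinv p => m 2 p
  | CLam p => m 3 p | CUt p => m 4 p | CLt p => m 5 p
  | CMu i => w 0 i | CGain i => w 1 i | CRes i => w 2 i | CProj i => w 3 i
  | CMut i => w 4 i | CY a => o 0 a | CH a => o 1 a | CV a => o 2 a
  end%N.

Definition hv_decode (c : hv_code) : option hv_cell :=
  Some match c with
  | inl (inl (k, p)) => match val k with
    | 0 => CSigma p | 1 => CL p | 2 => CLinv p | 3 => CLam p | 4 => CUt p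
    | _ => CLt p end
  | inl (inr (k, i)) => match val k with
    | 0 => CMu i | 1 => CGain i | 2 => CRes i | 3 => CProj i | _ => CMut i end
  | inr (k, a) => match val k with
    | 0 => CY a | 1 => CH a | _ => CV a end
  end%N.

Lemma hv_encodeK : pcancel hv_encode hv_decode.
Proof. by case=> p; rewrite /hv_decode /= inordK. Qed.

HB.instance Definition _ := Finite.copy hv_cell (pcan_type hv_encodeK).

Lemma card_hv_cell : (#|{: hv_cell}| <= 6 * #|{: pat}| + 8 * n)%N.
Proof.
apply: leq_trans (leq_card _ (pcan_inj hv_encodeK)) _.
rewrite !card_sum !card_prod !card_ord.
by have := max_card I; rewrite card_ord; move: #|{: pat}|; lia.
Qed.

Hypothesis Srefl : forall i, S i i.

(* Junk value (i, i) unless [S i j]. *)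
Definition pat_at (i j : 'I_n) : pat :=
  insubd (exist (fun p : 'I_n * 'I_n => S p.1 p.2) (i, i) (Srefl i)) (i, j).

Lemma val_at i j : S i j -> val (pat_at i j) = (i, j).
Proof. by move=> Sij; rewrite insubdK. Qed.

Definition terms_on (Q : pred 'I_n) (f g : 'I_n -> hv_cell) :=
  [seq (f k, g k) | k <- enum 'I_n & Q k].

Lemma size_terms_on Q f g : size (terms_on Q f g) = #|[pred k | Q k]|.
Proof. by rewrite size_map size_filter -sum1_count big_enum_cond sum1_card. Qed.

Lemma sum_terms_on (R : pzSemiRingType) (v : hv_cell -> R) Q f g :
  \sum_(ab <- terms_on Q f g) v ab.1 * v ab.2 = \sum_(k | Q k) v (f k) * v (g k).
Proof. by rewrite big_map big_filter big_enum_cond. Qed.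

Definition observed (i : 'I_n) : option 'I_#|I| := [pick a | enum_val a == i].

(** Used for unobserved indices; for input cells it is a placeholder that is never compiled, since
    no stage list contains them. *)
Definition zero_task : task hv_cell := Task (Const _ false) false [::] (Keep _).

Definition inv_task (D W : pat -> hv_cell) (i j : 'I_n) : task hv_cell :=
  Task (Const _ (i == j)) true
    (terms_on (fun k => [&& S i k, S k j & (k < i)%N])
       (fun k => D (pat_at i k)) (fun k => W (pat_at k j)))
    (Quot (D (pat_at i i))).

(** For [S i j], a sum over common descendants runs over those of i, and a sum over common ancestors
    over those of j, by transitivity. The last step multiplies by Lt^T and then by Lt, never forming
    Lt Lt^T. *)
Definition hv_todo (x : hv_cell) : task hv_cell :=
  match x with
  | CL p => let: (i, j) := val p in
    Task (Copy (CSigma p)) true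
      (terms_on (fun k => S j k && (k < j)%N)
         (fun k => CL (pat_at i k)) (fun k => CL (pat_at j k)))
      (if i == j then Root _ else Quot (CL (pat_at j j)))
  | CLinv p => inv_task CL CLinv (val p).1 (val p).2
  | CGain i => if observed i is Some a
    then Task (Const _ true) false [::] (Quot (CV a)) else zero_task
  | CLam p => let: (i, j) := val p in
    Task (if i == j then Copy (CGain i) else Const _ false) false
      (terms_on (fun k => S k i)
         (fun k => CLinv (pat_at k i)) (fun k => CLinv (pat_at k j)))
      (Keep _)
  | CUt p => let: (i, j) := val p in
    Task (Copy (CLam p)) true
      (terms_on (fun k => S k i && (i < k)%N)
         (fun k => CUt (pat_at k j)) (fun k => CUt (pat_at k i)))
      (if i == j then Root _ else Quot (CUt (pat_at i i)))
  | CLt p => inv_task CUt CLt (val p).1 (val p).2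
  | CRes i => if observed i is Some a
    then Task (Copy (CY a)) true [:: (CH a, CMu i)] (Quot (CV a)) else zero_task
  | CProj j => Task (Const _ false) false
      (terms_on (fun k => S k j) (fun k => CLt (pat_at k j)) CRes) (Keep _)
  | CMut i => Task (Copy (CMu i)) false
      (terms_on (fun k => S i k) (fun k => CLt (pat_at i k)) CProj) (Keep _)
  | _ => zero_task
  end.

(** Inputs have stage 0. Step 3 of the algorithm takes stages 3 and 4, step 6 takes stages 7 to
    9. *)
Definition stage (x : hv_cell) : nat :=
  match x with
  | CL _ => 1 | CLinv _ => 2 | CGain _ => 3 | CLam _ => 4 | CUt _ => 5
  | CLt _ => 6 | CRes _ => 7 | CProj _ => 8 | CMut _ => 9 | _ => 0
  end%N.

(** Within a stage, operands have a smaller index sum; for [CUt] the order is reversed, because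
    elimination starts from the last index. *)
Definition rank (x : hv_cell) : nat :=
  match x with
  | CL p | CLinv p | CLt p => ((val p).1 + (val p).2)%N
  | CUt p => ((n - (val p).1) + (n - (val p).2))%N
  | _ => 0%N
  end.

Hypothesis Slow : forall i j, S i j -> (j <= i)%N.
Hypothesis Strans : forall i j k, S i j -> S j k -> S i k.

Lemma mem_reads (t : task hv_cell) y : y \in reads t ->
  [\/ t_start t = Copy y,
      exists2 ab, ab \in t_terms t & y = ab.1 \/ y = ab.2 |
      t_finish t = Quot y].
Proof.
rewrite /reads !mem_cat => /or3P[|/flatten_mapP[ab abt]|].
- by case: (t_start t) => // z; rewrite inE => /eqP ->; constructor 1.
- rewrite !inE => /orP yab; constructor 2; exists ab => //.
  by case: yab => /eqP; [left|right].
- by case: (t_finish t) => // z; rewrite inE => /eqP ->; constructor 3.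
Qed.

Lemma mem_terms_on Q f g ab : ab \in terms_on Q f g -> exists2 k, Q k & ab = (f k, g k).
Proof. by case/mapP=> k; rewrite mem_filter => /andP[Qk _] ->; exists k. Qed.

Lemma inv_task_before (D W : pat -> hv_cell) (s : nat) (p : pat) y :
  (forall p, stage (D p) < s)%N -> (forall p, stage (W p) = s) ->
  (forall p, rank (W p) = (val p).1 + (val p).2)%N ->
  y \in reads (inv_task D W (val p).1 (val p).2) ->
  (stage y < s)%N || (stage y == s) && (rank y < (val p).1 + (val p).2)%N.
Proof.
move=> Ds Ws Wr; case/mem_reads => [//|[ab /mem_terms_on[k /and3P[Sik Skj ki] ->]]|[<-]].
  case=> -> /=; first by rewrite Ds.
  by rewrite Ws Wr val_at //= eqxx ltn_add2r ki orbT.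
by rewrite Ds.
Qed.

Lemma reads_before x y : (0 < stage x)%N -> y \in reads (hv_todo x) ->
  (stage y < stage x)%N || (stage y == stage x) && (rank y < rank x)%N.
Proof.
case: x => // p _; rewrite /hv_todo.
- case E : (val p) => [i j]; have /= Sij := valP p; rewrite E /= in Sij.
  case/mem_reads => /= [[<- //]|[ab /mem_terms_on[k /andP[Sjk kj] ->]]|].
    have Sik := Strans Sij Sjk; have ji := Slow Sij.
    by case=> -> /=; rewrite !val_at // E /=; lia.
  case: eqP => // /eqP ij [<-] /=; rewrite val_at // E /=.
  by have := Slow Sij; move: ij; rewrite -val_eqE /=; lia.
- by move=> yr; have := inv_task_before (s := 2) _ _ _ yr; exact.
- case E : (val p) => [i j]; have /= Sij := valP p; rewrite E /= in Sij.
  case/mem_reads => /= [|[ab /mem_terms_on[k Ski ->] [-> //|-> //]]|//].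
  by case: eqP => // _ [<-].
- case E : (val p) => [i j]; have /= Sij := valP p; rewrite E /= in Sij.
  case/mem_reads => /= [[<- //]|[ab /mem_terms_on[k /andP[Ski ik] ->]]|].
    have Skj := Strans Ski Sij; have ji := Slow Sij; have kn := ltn_ord k.
    by case=> -> /=; rewrite !val_at // E /=; lia.
  case: eqP => // /eqP ij [<-] /=; rewrite val_at // E /=.
  by have := Slow Sij; have := ltn_ord i; move: ij; rewrite -val_eqE /=; lia.
- by move=> yr; have := inv_task_before (s := 6) _ _ _ yr; exact.
- by case: (observed p) => [a|] //; rewrite inE => /eqP ->.
- case: (observed p) => [a|] //; rewrite !inE.
  by case/or4P => /eqP ->.
- by case/mem_reads => //= [[ab /mem_terms_on[k _ ->] [-> //|-> //]]].
- by case/mem_reads => /= [[<-]|[ab /mem_terms_on[k _ ->] [-> //|-> //]]|].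
Qed.

Definition ordered (T : finType) (f : T -> hv_cell) : seq hv_cell :=
  [seq f p | p <- sort (relpre (rank \o f) leq) (enum T)].

Definition stage_cells (k : nat) : seq hv_cell :=
  match k with
  | 1 => ordered CL | 2 => ordered CLinv | 3 => ordered CGain | 4 => ordered CLam
  | 5 => ordered CUt | 6 => ordered CLt | 7 => ordered CRes | 8 => ordered CProj
  | _ => ordered CMut
  end%N.

Lemma ordered_sorted (T : finType) (f : T -> hv_cell) :
  sorted (relpre rank leq) (ordered f).
Proof. by rewrite sorted_map sort_sorted // => p q; exact: leq_total. Qed.

Lemma mem_ordered (T : finType) (f : T -> hv_cell) x :
  reflect (exists p, x = f p) (x \in ordered f).
Proof.
apply: (iffP mapP) => [[p _ ->]|[p ->]]; exists p => //.
by rewrite mem_sort mem_enum.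
Qed.

Lemma big_ordered (T : finType) (f : T -> hv_cell) (F : hv_cell -> nat) :
  (\sum_(x <- ordered f) F x = \sum_p F (f p))%N.
Proof. by rewrite big_map (perm_big _ (permEl (perm_sort _ _))) big_enum. Qed.

Lemma size_ordered (T : finType) (f : T -> hv_cell) : size (ordered f) = #|{: T}|.
Proof. by rewrite size_map size_sort -cardE. Qed.

Lemma stage_cells_sorted k : sorted (relpre rank leq) (stage_cells k).
Proof. by do 9?[case: k => [|k]]; exact: ordered_sorted. Qed.

Lemma mem_stage_cells k x : (0 < k <= 9)%N -> (x \in stage_cells k) = (stage x == k).
Proof.
case: k => [|[|[|[|[|[|[|[|[|[|k]]]]]]]]]] // _; apply/mem_ordered/idP;
  by [case=> p -> | case: x => // p _; exists p].
Qed.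

(** * Counting cells and products *)

Section Counting.
Variable K : nat.
Hypothesis row_size : forall i, (#|[pred k | S i k]| <= K)%N.

Lemma sum_pat (F : 'I_n -> nat) :
  (\sum_(p : pat) F (val p).1 = \sum_i \sum_(j | S i j) F i)%N.
Proof.
rewrite (pair_big_dep xpredT (fun i j => S i j) (fun i _ => F i)) /=.
by rewrite (big_sub (fun p : 'I_n * 'I_n => S p.1 p.2) (fun p => F p.1)).
Qed.

Lemma card_pat_rows : #|{: pat}| = (\sum_i #|[pred k | S i k]|)%N.
Proof.
rewrite -sum1_card (sum_pat (fun _ => 1%N)); apply: eq_bigr => i _.
by rewrite sum1_card.
Qed.

Lemma card_pat_cols : #|{: pat}| = (\sum_i #|[pred k | S k i]|)%N.
Proof.
rewrite card_pat_rows; under eq_bigr do rewrite -sum1_card.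
under [RHS]eq_bigr do rewrite -sum1_card.
by rewrite (exchange_big_dep xpredT).
Qed.

Lemma card_pat : (#|{: pat}| <= n * K)%N.
Proof.
rewrite card_pat_rows -[X in (_ <= X * _)%N](card_ord n) -sum_nat_const.
exact: leq_sum.
Qed.

Lemma sum_row_terms (f : pat -> hv_cell) :
  (forall p, size (t_terms (hv_todo (f p))) <= #|[pred k | S (val p).1 k]|)%N \/
  (forall p, size (t_terms (hv_todo (f p))) <= #|[pred k | S (val p).2 k]|)%N ->
  (\sum_(x <- ordered f) size (t_terms (hv_todo x)) <= n * K ^ 2)%N.
Proof.
move=> fK; rewrite big_ordered; apply: (@leq_trans (\sum_(p : pat) K)%N).
  by apply: leq_sum => p _; case: fK => /(_ p)/leq_trans; apply.
by rewrite sum_nat_const expnS expn1 mulnA leq_mul2r card_pat orbT.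
Qed.

(** A column of [S] can be long, as a root may have many descendants, so no bound per task is
    available. Grouping the pairs by i gives the number of ancestors of i, at most K, times the
    number of its descendants; the latter add up to the size of the pattern, at most n K. *)
Lemma sum_col_terms (f : pat -> hv_cell) :
  (forall p, size (t_terms (hv_todo (f p))) <= #|[pred k | S k (val p).1]|)%N ->
  (\sum_(x <- ordered f) size (t_terms (hv_todo x)) <= n * K ^ 2)%N.
Proof.
move=> fK; rewrite big_ordered.
apply: (@leq_trans (\sum_(p : pat) #|[pred k | S k (val p).1]|)%N); first exact: leq_sum.
rewrite (sum_pat (fun i => #|[pred k | S k i]|)).
apply: (@leq_trans (\sum_i K * #|[pred k | S k i]|)%N).
  apply: leq_sum => i _; rewrite sum_nat_const leq_mul2r; apply/orP; right.
  exact: row_size.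
rewrite -big_distrr /= -card_pat_cols expnS expn1 mulnCA leq_mul2l.
by rewrite card_pat orbT.
Qed.

Lemma subpred_card (T : finType) (P Q : pred T) :
  (forall k, P k -> Q k) -> (#|[pred k | P k]| <= #|[pred k | Q k]|)%N.
Proof. by move=> PQ; apply/subset_leq_card/subsetP => k; exact: PQ. Qed.

(** The three summands bound the matrix stages, the matrix-vector products and the residual
    respectively; adding them gives one bound for all stages. *)
Lemma sum_stage_terms k : (0 < k <= 9)%N ->
  (\sum_(x <- stage_cells k) size (t_terms (hv_todo x)) <= n * K ^ 2 + n * K + n)%N.
Proof.
have inv (D W : pat -> hv_cell) p :
    (size (t_terms (inv_task D W (val p).1 (val p).2)) <=
     #|[pred k | S (val p).1 k]|)%N.
  by rewrite size_terms_on; apply: subpred_card => j /and3P[].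
have quad m : (m <= n * K ^ 2 -> m <= n * K ^ 2 + n * K + n)%N by lia.
have lin m : (m <= n * K -> m <= n * K ^ 2 + n * K + n)%N by lia.
have obs m : (m <= n -> m <= n * K ^ 2 + n * K + n)%N by lia.
case: k => [|[|[|[|[|[|[|[|[|[|k]]]]]]]]]] // _; rewrite /stage_cells.
- apply/quad/sum_row_terms; right=> -[[i j] Sij]; rewrite /= size_terms_on.
  by apply: subpred_card => k /andP[].
- by apply/quad/sum_row_terms; left=> p; exact: inv.
- rewrite big_ordered big1 // => i _ /=; by case: observed.
- apply/quad/sum_col_terms => -[[i j] Sij]; rewrite /= size_terms_on.
  exact: subpred_card.
- apply/quad/sum_col_terms => -[[i j] Sij]; rewrite /= size_terms_on.
  by apply: subpred_card => k /andP[].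
- by apply/quad/sum_row_terms; left=> p; exact: inv.
- apply: obs; rewrite big_ordered -[X in (_ <= X)%N](card_ord n) -sum1_card.
  by apply: leq_sum => i _ /=; case: observed.
- apply: lin; rewrite big_ordered; apply: leq_trans card_pat.
  by rewrite card_pat_cols; apply: leq_sum => i _; rewrite /= size_terms_on.
- apply: lin; rewrite big_ordered; apply: leq_trans card_pat.
  by rewrite card_pat_rows; apply: leq_sum => i _; rewrite /= size_terms_on.
Qed.

Lemma size_stage_cells k : (size (stage_cells k) <= n * K + n)%N.
Proof.
have := card_pat; case: k => [|[|[|[|[|[|[|[|[|k]]]]]]]]] /=;
  by rewrite size_ordered ?card_ord; move: #|{: pat}|; lia.
Qed.

Lemma size_compile_stage k : (0 < k <= 9)%N ->
  (size (compile hv_todo (stage_cells k)) <= 2 * (n * K ^ 2 + 2 * (n * K) + 2 * n))%N.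
Proof.
move=> /sum_stage_terms; have := size_stage_cells k.
have := size_compile hv_todo (stage_cells k).
move: (\sum_(_ <- _) _)%N (size _) (size _); lia.
Qed.

End Counting.

End HVProgram.

(** * Correctness *)

Section Correctness.
Variables (R : realType) (n : nat) (S : 'M[bool]_n) (I : {set 'I_n}).
Hypotheses (Spat : order_pattern S).
Hypothesis Schain : forall i j k, S i j -> S i k -> (k <= j)%N -> S j k.
Variables (mu : 'cV[R]_n) (Sigma : 'M[R]_n) (tau : 'I_n -> R) (y : 'cV[R]_#|I|).
Hypothesis Sigma_pd : posdefmx Sigma.
Hypothesis tau_gt0 : forall i, i \in I -> 0 < tau i ^+ 2.

Let H := obsmx R I.
Let V := noisemx I tau.
Let L := ichol Sigma S.
Let U := (invmx L)^T.
Let Lam := U *m U^T + H^T *m invmx V *m H.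
Let Ut := revmx *m revchol S Lam *m revmx.
Let Lt := (invmx Ut)^T.
Let res := H^T *m invmx V *m (y - H *m mu).
Let proj := Lt^T *m res.
Let mut := mu + Lt *m proj.

Definition hv_val (x : hv_cell S I) : R :=
  match x with
  | CSigma p => Sigma (val p).1 (val p).2
  | CL p => L (val p).1 (val p).2
  | CLinv p => invmx L (val p).1 (val p).2
  | CLam p => Lam (val p).1 (val p).2
  | CUt p => Ut (val p).2 (val p).1
  | CLt p => Lt (val p).1 (val p).2
  | CMu i => mu i 0 | CGain i => (H^T *m invmx V *m H) i i
  | CRes i => res i 0 | CProj i => proj i 0 | CMut i => mut i 0
  | CY a => y a 0 | CH a => H a (enum_val a) | CV a => V a a
  end.

Lemma noise_gt0 (a : 'I_#|I|) : 0 < V a a.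
Proof. by rewrite !mxE eqxx mulr1n tau_gt0 // enum_valP. Qed.

Lemma noise_mul : V *m diag_mx (\row_a (V a a)^-1) = 1%:M.
Proof.
rewrite /V /noisemx mulmx_diag -[RHS]diag_const_mx; congr diag_mx.
apply/rowP => a; rewrite !mxE eqxx mulr1n divff //.
by have := noise_gt0 a; rewrite !mxE eqxx mulr1n => /gt_eqF ->.
Qed.

Lemma noise_unitmx : V \in unitmx.
Proof. by have [] := mulmx1_unit noise_mul. Qed.

Lemma noise_invmx : invmx V = diag_mx (\row_a (V a a)^-1).
Proof. by rewrite -[RHS]mul1mx -(mulVmx noise_unitmx) -mulmxA noise_mul mulmx1. Qed.

Lemma sum_observed i (F : 'I_#|I| -> R) :
  \sum_a (i == enum_val a)%:R * F a = if observed I i is Some a then F a else 0.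
Proof.
rewrite /observed; case: pickP => [a /eqP ai|none].
  rewrite (bigD1 a) //= big1 ?ai ?eqxx ?mul1r ?addr0 // => b ba.
  by rewrite -ai (inj_eq enum_val_inj) eq_sym (negPf ba) mul0r.
by rewrite big1 // => a _; rewrite eq_sym none mul0r.
Qed.

Lemma obs_mulE (F : 'cV[R]_#|I|) i :
  (H^T *m invmx V *m F) i 0 =
  if observed I i is Some a then F a 0 / V a a else 0.
Proof.
rewrite -sum_observed mxE; apply: eq_bigr => a _.
rewrite noise_invmx mul_mx_diag [X in X * _]mxE [_^T _ _]mxE [H _ _]mxE.
by rewrite [(\row_ _ _) _ _]mxE -mulrA [F a 0 / _]mulrC.
Qed.

(** Each row of [H] has a single nonzero entry, so H^T V^{-1} H is diagonal. *)
Lemma gain_entry i j : (H^T *m invmx V *m H) i j =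
  if i == j then (H^T *m invmx V *m H) i i else 0.
Proof.
case: eqVneq => [<- //|ij]; rewrite mxE big1 // => a _.
rewrite noise_invmx mul_mx_diag [X in X * _]mxE ![_^T _ _]mxE ![H _ _]mxE.
case: eqVneq => [<-|_]; last by rewrite !mul0r.
by rewrite eq_sym (negPf ij) mulr0.
Qed.

Lemma gain_diag i : (H^T *m invmx V *m H) i i =
  if observed I i is Some a then 1 / V a a else 0.
Proof.
have -> : (H^T *m invmx V *m H) i i = (H^T *m invmx V *m col i H) i 0.
  by rewrite [LHS]mxE [RHS]mxE; apply: eq_bigr => a _; rewrite [col _ _ _ _]mxE.
rewrite obs_mulE /observed; case: pickP => // a /eqP ai.
by rewrite !mxE ai eqxx.
Qed.

Lemma Lam_pd : posdefmx Lam.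
Proof.
rewrite /Lam noise_invmx; apply: posdefmx_sum => [v v0|a].
  rewrite /U trmxK; apply: contra v0 => /eqP e.
  have Lu := prior_unitmx Spat Schain Sigma_pd.
  by rewrite -[v]mul1mx -(mulmxV Lu) -mulmxA e mulmx0.
by rewrite mxE invr_ge0 ltW // noise_gt0.
Qed.

Lemma Linv_patterned : patterned S (invmx L).
Proof. exact: prior_invmx_patterned. Qed.

Lemma Lam_sum i j : Lam i j =
  (\sum_k invmx L k i * invmx L k j) + (if i == j then (H^T *m invmx V *m H) i i else 0).
Proof.
rewrite /Lam mxE; congr (_ + _); last exact: gain_entry.
rewrite mxE; apply: eq_bigr => k _.
by rewrite /U trmxK mxE.
Qed.

(** A nonzero term of (U U^T)_{ij} requires a common descendant of i and j, which makes them
    comparable. *)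
Lemma Lam_sparse i j : ~~ S i j -> ~~ S j i -> Lam i j = 0.
Proof.
move=> nij nji; rewrite Lam_sum.
have -> : (i == j) = false.
  by apply: contraNF nij => /eqP ->; exact: (pat_refl Spat).
rewrite addr0 big1 // => k _.
have [ki|/Linv_patterned ->] := boolP (S k i); last by rewrite mul0r.
have [kj|/Linv_patterned ->] := boolP (S k j); last by rewrite mulr0.
by case: (pattern_comparable Schain ki kj) => e; rewrite e in nij nji.
Qed.

Lemma Ut_patterned : patterned S Ut^T.
Proof. exact: revchol_patterned. Qed.

Lemma Ut_diag_gt0 i : 0 < Ut i i.
Proof. by apply: (revchol_diag_gt0 Spat Schain Lam_pd); exact: Lam_sparse. Qed.

Lemma Ut_tr_diag_neq0 i : Ut^T i i != 0.
Proof. by rewrite mxE gt_eqF // Ut_diag_gt0. Qed.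

Lemma Ut_unitmx : Ut \in unitmx.
Proof.
rewrite -unitmx_tr.
exact: patterned_unitmx Spat Ut_patterned Ut_tr_diag_neq0.
Qed.

Lemma LtE : Lt = invmx Ut^T.
Proof. by rewrite /Lt trmx_inv. Qed.

Lemma Lt_patterned : patterned S Lt.
Proof.
by rewrite LtE; exact: invmx_patterned Spat Ut_patterned Ut_tr_diag_neq0.
Qed.

Let todo := @hv_todo n S I (pat_refl Spat).

(** The final values solve all the task equations, and no division or root fails at them. The order
    of execution is dealt with separately. *)
Lemma hv_task_val x : (0 < stage x)%N -> task_val hv_val (todo x) = Some (hv_val x).
Proof.
have ok := val_at (pat_refl Spat).
have inv (D W : {p : 'I_n * 'I_n | S p.1 p.2} -> hv_cell S I) (A : 'M[R]_n) p :
    patterned S A -> (forall i, A i i != 0) ->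
    (forall p, hv_val (D p) = A (val p).1 (val p).2) ->
    (forall p, hv_val (W p) = (invmx A) (val p).1 (val p).2) ->
    task_val hv_val (inv_task (pat_refl Spat) D W (val p).1 (val p).2)
    = Some (hv_val (W p)).
  move=> AT nz DE WE; rewrite /task_val /task_sum /= sum_terms_on /= DE.
  rewrite ok ?(pat_refl Spat) //= (negPf (nz _)) WE.
  rewrite (invmx_row Spat AT nz) ?(valP p) // expr1 mulN1r.
  congr (Some ((_ - _) / _)); apply: eq_bigr => k /and3P[ik kj _].
  by rewrite DE WE !ok.
case: x => // p _; rewrite /todo /hv_todo.
- case E : (val p) => [i j]; have /= Sij := valP p; rewrite E /= in Sij.
  have LT := ichol_patterned Sigma Spat.
  have Lpos := prior_diag_gt0 Spat Schain Sigma_pd.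
  have sumE : \sum_(k | S j k && (k < j)%N)
      hv_val (CL I (pat_at (pat_refl Spat) i k)) *
      hv_val (CL I (pat_at (pat_refl Spat) j k)) =
      \sum_(k < n | (k < j)%N) L i k * L j k.
    rewrite big_mkcondl; apply: eq_bigr => k kj; case: ifPn => Sjk.
      by rewrite /= !ok // (pat_trans Spat Sij).
    by rewrite [L j k]LT ?mulr0.
  rewrite /task_val /task_sum /= sum_terms_on E /= expr1 mulN1r sumE {sumE}.
  have := icholE Sigma S i j; rewrite /ichol_entry -/L.
  case: eqVneq => [->|ji].
    rewrite ltnn => /= e.
    (* The radicand is positive because its root is the pivot, already known to be positive. *)
    have d0 : 0 < Sigma i i - \sum_(k < n | (k < i)%N) L i k ^+ 2.
      by rewrite -sqrtr_gt0 -e.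
    under eq_bigr do rewrite -expr2.
    by rewrite ltNge (ltW d0) /= -e.
  rewrite ltn_neqAle (pat_low Spat Sij) andbT ji Sij /= => ->.
  by rewrite ok ?(pat_refl Spat) //= gt_eqF.
- apply: inv => //; first exact: ichol_patterned.
  exact: prior_diag_neq0.
- case E : (val p) => [i j]; have /= Sij := valP p; rewrite E /= in Sij.
  rewrite /task_val /task_sum /= sum_terms_on E /= expr0 mul1r Lam_sum addrC.
  congr (Some (_ + _)); last by case: eqP.
  rewrite [RHS](bigID (fun k => S k i)) /= [X in _ + X]big1 ?addr0.
    apply: eq_bigr => k Ski.
    by rewrite /= !ok // (pat_trans Spat Ski).
  by move=> k /Linv_patterned ->; rewrite mul0r.
- case E : (val p) => [i j]; have /= Sij := valP p; rewrite E /= in Sij.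
  have := revchol_entry Spat Schain Lam_pd Lam_sparse Sij; rewrite -/Ut => e.
  rewrite /task_val /task_sum /= sum_terms_on E /= expr1 mulN1r.
  rewrite (eq_bigr (fun k => Ut j k * Ut i k)); last first.
    by move=> k /andP[Ski _]; rewrite /= !ok // (pat_trans Spat Ski).
  (* On the diagonal the accumulated value is [Ut i i] squared, and its root is [Ut i i] because
     that entry is positive. *)
  rewrite e; have [ij|ij] /= := eqVneq i j.
    subst j; rewrite ltNge ltW ?mulr_gt0 ?Ut_diag_gt0 //=.
    by rewrite -expr2 sqrtr_sqr ger0_norm // ltW // Ut_diag_gt0.
  rewrite ok ?(pat_refl Spat) //= gt_eqF ?Ut_diag_gt0 // mulfK //.
  by rewrite gt_eqF // Ut_diag_gt0.
- apply: (inv _ _ Ut^T).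
  + exact: Ut_patterned.
  + exact: Ut_tr_diag_neq0.
  + by move=> q; rewrite [RHS]mxE.
  + by move=> q; rewrite -LtE.
- have -> : hv_val (CGain S I p) = if observed I p is Some a then 1 / V a a else 0.
    exact: gain_diag.
  case: (observed I p) => [a|]; rewrite /task_val /task_sum /= big_nil mulr0 addr0 //.
  by rewrite gt_eqF ?noise_gt0.
- have -> : hv_val (CRes S I p) =
      if observed I p is Some a then (y - H *m mu) a 0 / V a a else 0.
    exact: obs_mulE.
  rewrite /observed; case: pickP => [a /eqP ai|_];
    rewrite /task_val /task_sum /=; last by rewrite big_nil mulr0 addr0.
  rewrite gt_eqF ?noise_gt0 // big_seq1 /= expr1 mulN1r.
  suff -> : (y - H *m mu) a 0 = y a 0 - H a (enum_val a) * mu p 0 by [].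
  rewrite !mxE -ai (bigD1 (enum_val a)) //= big1 ?addr0 ?mxE // => k ka.
  by rewrite mxE (negPf ka) mul0r.
- rewrite /task_val /task_sum /= sum_terms_on expr0 mul1r add0r; congr Some.
  rewrite [RHS]mxE [RHS](bigID (fun k => S k p)) /= [X in _ + X]big1 ?addr0.
    apply: eq_bigr => k Skp.
    by rewrite /= !ok // [Lt^T _ _]mxE.
  by move=> k /Lt_patterned e; rewrite [Lt^T _ _]mxE e mul0r.
- rewrite /task_val /task_sum /= sum_terms_on expr0 mul1r; congr Some.
  rewrite [RHS]mxE; congr (_ + _).
  rewrite [RHS]mxE [RHS](bigID (fun k => S p k)) /= [X in _ + X]big1 ?addr0.
    by apply: eq_bigr => k Spk; rewrite /= !ok.
  by move=> k /Lt_patterned e; rewrite e mul0r.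
Qed.

(** [U] and [Ut] are read through transposed layouts, and the two symmetric entries of [Lam] share
    one cell. *)
Definition hv_prog : hv_program S I :=
  let run k := compile todo (stage_cells S I k) in
  let store (x : {p : 'I_n * 'I_n | S p.1 p.2} -> hv_cell S I) i j :=
    if S i j then Some (loc (x (pat_at (pat_refl Spat) i j))) else None in
  @HVProgram n S I (machine_size (hv_cell S I))
    (fun x => loc match x with
      | @InSigma _ _ _ i j Sij =>
          CSigma I (exist (fun p : 'I_n * 'I_n => S p.1 p.2) (i, j) Sij)
      | InMu i => CMu S I i | InY a => CY S a | InH a => CH S a | InV a => CV S a
      end)
    (run 1%N) (run 2%N) (run 3%N ++ run 4%N) (run 5%N) (run 6%N)
    (run 7%N ++ run 8%N ++ run 9%N)
    (store (CL I)) (fun i j => store (CLinv I) j i)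
    (fun i j => if store (CLam I) i j is Some a then Some a else store (CLam I) j i)
    (fun i j => store (CUt I) j i) (store (CLt I)) (fun i => loc (CMut S I i)).

Lemma hv_input_inj : injective (hv_input hv_prog).
Proof.
move=> x z /enum_rank_inj; case: x => [i j Sij|i|a|a|a];
  case: z => [i' j' Sij'|i'|a'|a'|a'] //.
all: try by case=> ->.
case=> ii jj; subst i' j'; by rewrite (bool_irrelevance Sij Sij').
Qed.

Lemma agree_store m k (x : {p : 'I_n * 'I_n | S p.1 p.2} -> hv_cell S I) (A : 'M[R]_n) :
  agree (fun c => stage c <= k)%N m hv_val -> (forall p, (stage (x p) <= k)%N) ->
  (forall p, hv_val (x p) = A (val p).1 (val p).2) -> patterned S A ->
  stores_mx (fun i j =>
    if S i j then Some (loc (x (pat_at (pat_refl Spat) i j))) else None) m A.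
Proof.
move=> mv xk xA AT i j; case: ifPn => [Sij|/AT //].
by rewrite mv // xA val_at.
Qed.

Lemma hv_prog_correct : hv_correct hv_prog mu Sigma H V y.
Proof.
move=> m0 m0in.
have before := @reads_before n S I (pat_refl Spat) (pat_low Spat) (pat_trans Spat).
have run k m : (0 < k <= 9)%N -> agree (fun c => stage c <= k.-1)%N m hv_val ->
    exists2 m', exec (compile todo (stage_cells S I k)) m = Some m'
      & agree (fun c => stage c <= k)%N m' hv_val.
  move=> k9 mv; have k0 : (0 < k)%N by case/andP: k9.
  apply: (exec_compile before) => //.
  - exact: stage_cells_sorted.
  - by move=> c; exact: mem_stage_cells.
  - move=> c; rewrite mem_stage_cells // => /eqP ck; apply: hv_task_val.
    by rewrite ck.
  - by move=> c ck; apply: mv; rewrite -ltnS prednK.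
have mv0 : agree (fun c => stage c <= 0)%N m0 hv_val.
  case=> //= [[[i j] Sij]|i|a|a|a] _.
  - exact: m0in (InSigma I Sij).
  - exact: m0in (InMu S I i).
  - exact: m0in (InY S a).
  - exact: m0in (InH S a).
  - exact: m0in (InV S a).
have [m1 e1 v1] := run 1%N _ isT mv0.
have [m2 e2 v2] := run 2%N _ isT v1.
have [m3 e3 v3] := run 3%N _ isT v2.
have [m4 e4 v4] := run 4%N _ isT v3.
have [m5 e5 v5] := run 5%N _ isT v4.
have [m6 e6 v6] := run 6%N _ isT v5.
have [m7 e7 v7] := run 7%N _ isT v6.
have [m8 e8 v8] := run 8%N _ isT v7.
have [m9 e9 v9] := run 9%N _ isT v8.
(* [m3], [m7] and [m8] are intermediate memories inside steps 3 and 6. *)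
exists L, U, Lam, Ut, Lt, mut, m1, m2, m4, m5, m6, m9; split; last split; split.
- by [].
- exact: prior_diag_gt0.
- exact: prior_unitmx.
- by [].
- exact: noise_unitmx.
- by [].
- exists (revchol S Lam) => //.
  exact: (revchol_is_chol Spat Schain Lam_pd Lam_sparse).
- exact: Ut_unitmx.
- by [].
- by rewrite /mut /proj /res !mulmxA.
- by split=> //; apply: (agree_store v1) => //; exact: ichol_patterned.
- split=> // i j; rewrite mxE; exact: (agree_store v2 (x := CLinv I) _ _ Linv_patterned).
- split; first by rewrite exec_cat e3 /=.
  move=> i j /=; case: ifPn => [Sij|nij]; first by rewrite v4 //= val_at.
  case: ifPn => [Sji|nji]; last exact: Lam_sparse.
  have [LamT _] := Lam_pd; rewrite v4 //= val_at //= -[in LHS]LamT mxE //.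
- split=> // i j; rewrite -[Ut]trmxK mxE.
  by apply: (agree_store v5 (x := CUt I) _ _ Ut_patterned) => // p; rewrite mxE.
- by split=> //; apply: (agree_store v6) => //; exact: Lt_patterned.
- by rewrite exec_cat e7 /= exec_cat e8 /=.
- by apply: (agree_store v9) => //; exact: Lt_patterned.
- by move=> i; rewrite /= v9.
Qed.

End Correctness.

Theorem proposition4 (R : realType) :
  exists c : nat,
  forall (n M : nat) (J : M.-tuple nat) (X : seq nat -> {set 'I_n})
         (C : 'I_n -> {set 'I_n}) (I : {set 'I_n}) (N : nat),
  hierarchical_partition J X ->
  conditioning_sets J X C ->
  (1 <= N)%N ->
  (forall i, (#|C i| <= N)%N) ->
  exists p : hv_program (sparsity C) I,
  [/\ injective (hv_input p),
      (hv_time p <= c * (n * N ^ 2))%N,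
      (hv_space p <= c * (n * N))%N
    & forall (mu : 'cV[R]_n) (Sigma : 'M[R]_n) (tau : 'I_n -> R)
             (y : 'cV[R]_#|I|),
      posdefmx Sigma ->
      (forall i, i \in I -> 0 < tau i ^+ 2) ->
      hv_correct p mu Sigma (obsmx R I) (noisemx I tau) y].
Proof.
(* With K = 2 N, each of the nine stages takes at most 20 n N^2 instructions, and the memory has at
   most 40 n N cells; 360 covers both with room to spare. *)
exists 360%N => n M J X C I N hX hC N1 CN.
have [Spat Schain] := hierarchy_order_pattern hX hC.
(* A row has the elements of [C i] and the diagonal: at most N + 1, hence at most 2 N since N >=
   1. *)
have rows i : (#|[pred k | sparsity C i k]| <= 2 * N)%N.
  apply: (@leq_trans #|C i|.+1); last by have := CN i; lia.
  apply: leq_trans (_ : #|i |: C i| <= _)%N; last by rewrite cardsU1; case: (_ \notin _).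
  apply/subset_leq_card/subsetP => k; rewrite !inE mxE => /orP[->|/eqP ->].
    by rewrite orbT.
  by rewrite eqxx.
have quad : (n * (2 * N) ^ 2 = 4 * (n * N ^ 2))%N by rewrite expnMn; lia.
have lin : (n * N <= n * N ^ 2)%N by rewrite leq_mul2l expnS expn1 leq_pmulr ?orbT.
have nN : (n <= n * N)%N by rewrite leq_pmulr.
exists (hv_prog I Spat); split.
- exact: hv_input_inj.
- rewrite /hv_time /hv_prog /= !size_cat.
  have size_run := size_compile_stage I (pat_refl Spat) rows.
  have := (size_run 1%N isT, size_run 2%N isT, size_run 3%N isT, size_run 4%N isT,
    size_run 5%N isT, size_run 6%N isT, size_run 7%N isT, size_run 8%N isT,
    size_run 9%N isT).
  rewrite quad; case=> [[[[[[[[]]]]]]]].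
  do 9![move: (size (compile _ _))]; lia.
(* The scratch locations double the number of cells. *)
- rewrite /= /machine_size card_prod card_bool.
  have := card_hv_cell (sparsity C) I; have := card_pat rows.
  by move: #|_| #|_| => a b; lia.
- by move=> mu Sigma tau y pd tau0; exact: hv_prog_correct.
Qed.
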